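(* Let $p\in[1,2)$ and for each $n\in\mathbb N$ let $X^{(n,p)}$ be uniformly distributed on $n^{1/p}\mathbb B_p^n$, where $\mathbb B_p^n=\{x\in\mathbb R^n:\sum_{i}|x_i|^p\le1\}$. Let $\{k_n\}$ be a sequence of positive integers with $k_n\le n$, $k_n\to\infty$, $k_n/n\to0$, satisfying one of: $k_n\gg n^{2p/(2+p)}$; $k_n=n^{2p/(2+p)}$ (up to rounding to an integer, i.e. $|k_n-n^{2p/(2+p)}|<1$); or $k_n\ll n^{2p/(2+p)}$. Define $$s_n:=\begin{cases}n^pk_n^{-p/2},&\text{if }k_n\gg n^{2p/(2+p)},\\ n^{2p/(2+p)},&\text{if }k_n=n^{2p/(2+p)}\text{ (up to rounding) or }k_n\ll n^{2p/(2+p)},\end{cases}$$ and let $J_{X,p}(x)=x^p/p$ for $x\ge0$, $J_{X,p}(x)=+\infty$ for $x<0$. Then $s_n\to\infty$, $s_n/n\to0$, the limit $r:=\lim_n s_n/k_n\in[0,\infty]$ exists, and: 1. if $r\in[0,\infty)$, then $\{\sqrt{k_n}\,\|X^{(n,p)}\|_2/n\}_n$ satisfies an LDP in $\mathbb R$ at speed $s_n$ with GRF $J_{X,p}$; 2. if $r=\infty$, then $\{\sqrt{s_n}\,\|X^{(n,p)}\|_2/n\}_n$ satisfies an LDP in $\mathbb R$ at speed $s_n$ with GRF $J_{X,p}$.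
   Context: $\|\cdot\|_2$ is the Euclidean norm; $a_n\ll b_n$ (equivalently $b_n\gg a_n$) means $a_n/b_n\to0$. LDP: a sequence of random variables $\{\eta_n\}$ with values in a regular topological space $\mathcal X$ satisfies a large deviation principle (LDP) at speed $s_n$ (positive reals with $s_n\to\infty$) with rate function $I:\mathcal X\to[0,\infty]$ if $I$ is lower semicontinuous and for every Borel set $\Gamma$, $-\inf_{\Gamma^\circ}I\le\liminf_n\frac1{s_n}\log\mathbb P(\eta_n\in\Gamma)\le\limsup_n\frac1{s_n}\log\mathbb P(\eta_n\in\Gamma)\le-\inf_{\bar\Gamma}I$. It is a good rate function (GRF) if moreover its level sets are compact. *)

(* Defs.v *)
From HB Require Import structures.
From mathcomp Require Import all_boot all_order all_algebra.
From mathcomp Require Import all_classical all_reals all_analysis.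

Set Implicit Arguments.
Unset Strict Implicit.
Unset Printing Implicit Defensive.

Import Order.TTheory GRing.Theory Num.Theory.
Import numFieldNormedType.Exports.

Local Open Scope classical_set_scope.
Local Open Scope ring_scope.

(* The library proves this, but canonical structure inference does not find
   the corresponding instance. *)
Lemma sigma_finite_product (d1 d2 : measure_display)
    (T1 : measurableType d1) (T2 : measurableType d2) (R : realType)
    (m1 : {sigma_finite_measure set T1 -> \bar R})
    (m2 : {sigma_finite_measure set T2 -> \bar R}) :
  sigma_finite setT (m1 \x m2)%E.
Proof.
have /sigma_finiteP[F [TF ndF Foo]] := sigma_finiteT m1.
have /sigma_finiteP[G [TG ndG Goo]] := sigma_finiteT m2.
exists (fun n => F n `*` G n).
  rewrite -setXTT TF TG predeqE => -[x y]; split.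
    move=> [/= [n _ Fnx] [k _ Gky]]; exists (maxn n k) => //; split.
    - by move: x Fnx; exact/subsetPset/ndF/leq_maxl.
    - by move: y Gky; exact/subsetPset/ndG/leq_maxr.
  by move=> [n _ []/= ? ?]; split; exists n.
move=> k; have [? ?] := Foo k; have [? ?] := Goo k.
split; first exact: measurableX.
by rewrite product_measure1E// lte_mul_pinfty// ge0_fin_numE.
Qed.

(* R^n is the type n.-tuple R with its product sigma-algebra.  The library
   has no Lebesgue measure on it; it is built by induction on n, as the image
   of the binary product measure on R * R^n under (x, t) |-> x :: t. *)
Section lebesgue_succ.
Context {R : realType} {n : nat}.
Variable mu : {sigma_finite_measure set (n.-tuple R) -> \bar R}.

Definition tuple_uncurry (u : R * n.-tuple R) : n.+1.-tuple R :=
  [tuple of u.1 :: u.2].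

Definition tuple_split (t : n.+1.-tuple R) : R * n.-tuple R :=
  (thead t, [tuple of behead t]).

Lemma measurable_tuple_uncurry : measurable_fun setT tuple_uncurry.
Proof.
apply: (@measurable_cons _ _ (R * n.-tuple R)%type R fst n snd).
- exact: measurable_fst.
- exact: measurable_snd.
Qed.

Lemma measurable_tuple_split : measurable_fun setT tuple_split.
Proof.
apply: measurable_fun_pair; first exact: measurable_tnth.
exact: measurable_behead.
Qed.

Lemma tuple_uncurryK : cancel tuple_uncurry tuple_split.
Proof. by case=> x t; congr pair; apply: val_inj. Qed.

Definition lebesgue_succ : set (n.+1.-tuple R) -> \bar R :=
  pushforward (lebesgue_measure \x mu)%E tuple_uncurry.

Let lebesgue_succ0 : lebesgue_succ set0 = 0%E.
Proof. by rewrite /lebesgue_succ /pushforward preimage_set0 measure0. Qed.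

Let lebesgue_succ_ge0 A : (0 <= lebesgue_succ A)%E.
Proof. by rewrite /lebesgue_succ /pushforward; exact: measure_ge0. Qed.

Let lebesgue_succ_sigma_additive : semi_sigma_additive lebesgue_succ.
Proof.
have m := measurable_tuple_uncurry.
move=> F mF tF mUF; rewrite /lebesgue_succ /pushforward preimage_bigcup.
apply: measure_semi_sigma_additive.
- by move=> i; rewrite -[X in measurable X]setTI; exact: m.
- apply/trivIsetP => /= i j _ _ ij; rewrite -preimage_setI.
  by move/trivIsetP : tF => /(_ _ _ _ _ ij) ->//; rewrite preimage_set0.
- by rewrite -preimage_bigcup -[X in measurable X]setTI; exact: m.
Qed.

HB.instance Definition _ := isMeasure.Build _ _ _ lebesgue_succ
  lebesgue_succ0 lebesgue_succ_ge0 lebesgue_succ_sigma_additive.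

Let lebesgue_succ_sigma_finite : sigma_finite setT lebesgue_succ.
Proof.
have [F FT mF] := sigma_finite_product lebesgue_measure mu.
exists (fun i => tuple_split @^-1` F i).
  by rewrite -preimage_bigcup -FT preimage_setT.
move=> i; have [mFi Fioo] := mF i; split.
  by rewrite -[X in measurable X]setTI; exact: measurable_tuple_split.
rewrite /lebesgue_succ /pushforward -comp_preimage.
by rewrite (_ : _ \o _ = id) //; apply/funext => u; exact: tuple_uncurryK.
Qed.

HB.instance Definition _ := Measure_isSigmaFinite.Build _ _ _ lebesgue_succ
  lebesgue_succ_sigma_finite.

End lebesgue_succ.

Fixpoint lebesgue_tuple (R : realType) (n : nat) :
    {sigma_finite_measure set (n.-tuple R) -> \bar R} :=
  match n with
  | 0 => \d_([tuple] : 0.-tuple R)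
  | m.+1 => lebesgue_succ (lebesgue_tuple R m)
  end.

Lemma lebesgue_tuple_box (R : realType) (n : nat) (A : 'I_n -> set R) :
  (forall i, measurable (A i)) ->
  lebesgue_tuple R n [set t | forall i, A i (tnth t i)] =
  (\prod_(i < n) lebesgue_measure (A i))%E.
Proof.
elim: n A => [|n IH] A mA.
  by rewrite big_ord0 /= diracE mem_set// => -[].
rewrite big_ord_recl -(IH (fun i => A (lift ord0 i)))//.
have mB : measurable
    [set t : n.-tuple R | forall i, A (lift ord0 i) (tnth t i)].
  rewrite (_ : mkset _ =
    \bigcap_(i in [set: 'I_n]) ((@tnth _ R)^~ i @^-1` A (lift ord0 i))).
    apply: fin_bigcap_measurable => // i _.
    by rewrite -[X in measurable X]setTI; exact: measurable_tnth.
  by apply/seteqP; split=> t h i; [move=> _|]; exact: h.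
apply: etrans (product_measure1E lebesgue_measure (lebesgue_tuple R n)
  (mA ord0) mB).
rewrite [LHS]/= /lebesgue_succ /pushforward; congr ((_ \x _)%E _).
apply/seteqP; split=> -[x t] /=.
  move=> h; split; first by have := h ord0; rewrite tnth0.
  by move=> i; have := h (lift ord0 i); rewrite tnthS.
move=> [Ax At] i; have [j ->|->] := unliftP ord0 i; last by rewrite tnth0.
by rewrite tnthS; exact: At.
Qed.

Definition norm2 (R : realType) (n : nat) (x : n.-tuple R) : R :=
  Num.sqrt (\sum_(i < n) tnth x i ^+ 2).

Definition lp_ball (R : realType) (p : R) (n : nat) : set (n.-tuple R) :=
  [set x | \sum_(i < n) `|tnth x i| `^ p <= 1].
Arguments lp_ball {R} p n.

Definition scale_tuple (R : realType) (n : nat) (c : R) (x : n.-tuple R) :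
  n.-tuple R := [tuple c * tnth x i | i < n].

(* The identity at A = setT forces 0 < vol B < +oo. *)
Definition uniformly_distributed_on (d : measure_display)
    (Omega : measurableType d) (R : realType) (P : probability Omega R)
    (n : nat) (X : {RV P >-> n.-tuple R}) (B : set (n.-tuple R)) : Prop :=
  forall A, measurable A -> distribution P X A =
    (lebesgue_tuple R n (A `&` B) / lebesgue_tuple R n B)%E.

Definition negligible_to (R : realType) (a b : nat -> R) : Prop :=
  a n / b n @[n --> \oo] --> (0 : R).

(* Large deviations.  Sequences are indexed by n >= 1; the terms with index 0
   carry no information. *)
Section ldp.
Context (d : measure_display) (Omega : measurableType d) (R : realType).
Context (P : probability Omega R) (T : topologicalType).
Local Open Scope ereal_scope.

Definition borel_set (B : set T) : Prop := <<s [set U : set T | open U] >> B.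

Definition log_prob (s : nat -> R) (eta : nat -> Omega -> T) (B : set T)
  (n : nat) : \bar R := ((s n)^-1)%:E * lne (P (eta n @^-1` B)).

Definition is_rate_function (I : T -> \bar R) : Prop :=
  (forall x, 0 <= I x) /\ lower_semicontinuous I.

Definition is_good_rate_function (I : T -> \bar R) : Prop :=
  is_rate_function I /\ forall a : R, compact [set x | I x <= a%:E].

Definition satisfies_LDP (eta : nat -> Omega -> T) (s : nat -> R)
    (I : T -> \bar R) : Prop :=
  [/\ forall n B, (0 < n)%N -> borel_set B -> measurable (eta n @^-1` B),
      forall n, (0 < n)%N -> (0 < s n)%R,
      s n @[n --> \oo] --> +oo%R,
      is_rate_function I &
      forall B, borel_set B ->
        [/\ - ereal_inf (I @` B°) <= limn_einf (log_prob s eta B),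
            limn_einf (log_prob s eta B) <= limn_esup (log_prob s eta B) &
            limn_esup (log_prob s eta B) <= - ereal_inf (I @` closure B)]].

Definition satisfies_LDP_GRF (eta : nat -> Omega -> T) (s : nat -> R)
    (I : T -> \bar R) : Prop :=
  satisfies_LDP eta s I /\ is_good_rate_function I.

End ldp.

Definition crit_exponent (R : realType) (p : R) : R := 2 * p / (2 + p).

Definition crit_seq (R : realType) (p : R) (n : nat) : R :=
  n%:R `^ crit_exponent p.

Definition supercritical (R : realType) (p : R) (k : nat -> nat) : Prop :=
  negligible_to (crit_seq p) (fun n => (k n)%:R).

Definition critical (R : realType) (p : R) (k : nat -> nat) : Prop :=
  forall n, (0 < n)%N -> `|(k n)%:R - crit_seq p n| < 1.

Definition subcritical (R : realType) (p : R) (k : nat -> nat) : Prop :=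
  negligible_to (fun n => (k n)%:R) (crit_seq p).

(* The three regimes are pairwise exclusive, so a single test suffices. *)
Definition ldp_speed (R : realType) (p : R) (k : nat -> nat) (n : nat) : R :=
  if `[< supercritical p k >] then n%:R `^ p * (k n)%:R `^ (- (p / 2))
  else crit_seq p n.

Definition J_X (R : realType) (p : R) (x : R) : \bar R :=
  if 0 <= x then (x `^ p / p)%:E else +oo%E.

(* Main.v *)
Require Import Defs.
From mathcomp Require Import all_boot all_order all_algebra.
From mathcomp Require Import all_classical all_reals all_analysis.
From mathcomp Require Import measurable_realfun ring lra.

Import Order.TTheory GRing.Theory Num.Theory.
Import numFieldNormedType.Exports.

Set Implicit Arguments.
Unset Strict Implicit.
Unset Printing Implicit Defensive.

Local Open Scope classical_set_scope.
Local Open Scope ring_scope.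

(* Write S(x) for the sum of the |x_i|^p, Q(x) for the sum of the x_i^2 and
   V_k(r) for the volume of {S <= r} in R^k.  With m = k_n (resp. m = s_n when
   r is infinite) and tau_n = n / sqrt m, one has tau_n^p ~ s_n, and the norm
   exceeds x tau_n because of a single coordinate of size x tau_n, which has
   probability exp(-(x tau_n)^p / p + o(s_n)).

   Upper bound: the indicator of {S <= n} is at most exp((n - S) / p), and
   e^(n/p) (\int e^(-|z|^p / p) dz)^n exceeds V_n(n) by a polynomial factor
   only.  Under the resulting product measure, Chernoff's bound is applied not
   to Q, which has no exponential moments, but to the sum of the
   min (l x_i^2) ((1 - e) |x_i|^p / p), with l chosen so that the two branches
   meet at |x_i| = T.  This sum is at least (1 - e) T^p / p on {Q >= T^2}, and
   as n = o(T^2) its exponential moment costs only exp (o(T^p)).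

   Lower bound: let one coordinate range over a window near x tau_n; the others
   form a rescaled typical point of the ball in dimension n - 1, at the cost of
   a factor (1 - (x tau_n)^p / n)^((n - 1) / p) = exp(-(x tau_n)^p / p (1 + o(1))). *)

(** * Lebesgue measure on tuples *)

(** Slicing along the first coordinate: [lebesgue_succ] is an image of a product measure, which is
    itself the integral of the measures of the sections. *)
Lemma lebesgue_tupleS (R : realType) (n : nat) (A : set (n.+1.-tuple R)) :
  lebesgue_tuple R n.+1 A =
  (\int[lebesgue_measure]_z
     lebesgue_tuple R n [set y | A (tuple_uncurry (z, y))])%E.
Proof.
rewrite [LHS]/= /lebesgue_succ /pushforward /product_measure1.
apply: eq_integral => z _ /=; congr (lebesgue_tuple R n _).
by apply/seteqP; split=> y; rewrite /xsection/= ?inE.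
Qed.

Lemma ge0_integral_lebesgue_tupleS (R : realType) (n : nat)
    (f : n.+1.-tuple R -> \bar R) :
  measurable_fun setT f -> (forall x, 0 <= f x)%E ->
  (\int[lebesgue_tuple R n.+1]_x f x =
   \int[lebesgue_measure]_z
     \int[lebesgue_tuple R n]_y f (tuple_uncurry (z, y)))%E.
Proof.
move=> mf f0.
pose m2 : {sigma_finite_measure set (n.-tuple R) -> \bar R} := lebesgue_tuple R n.
(* The measure on [n.+1.-tuple R] is this image measure by conversion; naming it lets the change of
   variables and then Tonelli's theorem apply. *)
transitivity (\int[pushforward (lebesgue_measure \x m2)%E
  (@tuple_uncurry R n)]_x f x)%E.
  by [].
rewrite ge0_integral_pushforward//; last exact: measurable_tuple_uncurry.
rewrite preimage_setT.
apply: (fubini_tonelli1 (m1 := lebesgue_measure) (m2 := m2)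
  (f \o @tuple_uncurry R n)).
- by apply: measurableT_comp => //; exact: measurable_tuple_uncurry.
- by move=> x; exact: f0.
Qed.

Lemma measurable_tuple_section (R : realType) (n : nat)
    (A : set (n.+1.-tuple R)) (z : R) :
  measurable A -> measurable [set y | A (tuple_uncurry (z, y))].
Proof.
move=> mA.
have m1 : measurable_fun setT (fun y : n.-tuple R => tuple_uncurry (z, y)).
  apply: measurableT_comp; first exact: measurable_tuple_uncurry.
  exact: measurable_pair1.
by rewrite -[X in measurable X]setTI; exact: (m1 measurableT).
Qed.

Lemma measurable_fun_tuple_section (R : realType) (n : nat)
    (A : set (n.+1.-tuple R)) : measurable A ->
  measurable_fun setT
    (fun z : measurableTypeR R =>
       lebesgue_tuple R n [set y | A (tuple_uncurry (z, y))]).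
Proof.
move=> mA.
have mB : measurable (@tuple_uncurry R n @^-1` A).
  by rewrite -[X in measurable X]setTI; exact: measurable_tuple_uncurry.
have := @measurable_fun_xsection _ _ _ _ R (lebesgue_tuple R n) _ mB.
apply: eq_measurable_fun => z _ /=; congr (lebesgue_tuple R n _).
by apply/seteqP; split=> y; rewrite /xsection/= ?inE.
Qed.

(** The image of Lebesgue measure under multiplication by [c], weighted by [c], gives []a, b]] the
    mass b - a; uniqueness of Lebesgue measure concludes. *)
Lemma lebesgue_measure_scale (R : realType) (c : R)
    (A : set (measurableTypeR R)) : 0 < c -> measurable A ->
  lebesgue_measure A = (c%:E * lebesgue_measure ( *%R c @^-1` A))%E.
Proof.
move=> c0 mA.
have mc : measurable_fun setT ( *%R c : measurableTypeR R -> measurableTypeR R).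
  exact: mulrl_measurable.
pose pf : {measure set (measurableTypeR R) -> \bar R} :=
  measure_function_pushforward__canonical__measure_function_Measure
    lebesgue_measure mc.
pose m := mscale (NngNum (ltW c0)) pf.
transitivity (m A); last by [].
apply: lebesgue_measure_unique mA => _ [[a b]/= _ <-].
rewrite /m/= /mscale/= /pushforward.
rewrite (_ : _ @^-1` _ = `](c^-1 * a), (c^-1 * b)]%classic); last first.
  apply/seteqP; split=> x /=; rewrite !in_itv/=.
    by rewrite -ltr_pdivrMl// -ler_pdivlMl.
  by rewrite ltr_pdivrMl// ler_pdivlMl.
rewrite !lebesgue_measure_itv/= !lte_fin ltr_pM2l ?invr_gt0//.
case: ifPn => _; last by rewrite mule0.
by rewrite -EFinD -EFinM -mulrBr mulVKf ?gt_eqF.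
Qed.

Lemma ge0_integral_scale (R : realType) (c : R) (f : R -> \bar R) : 0 < c ->
  measurable_fun setT (f : measurableTypeR R -> _) -> (forall x, 0 <= f x)%E ->
  (\int[lebesgue_measure]_x f x = c%:E * \int[lebesgue_measure]_x f (c * x)%R)%E.
Proof.
move=> c0 mf f0.
have mc : measurable_fun setT ( *%R c : measurableTypeR R -> measurableTypeR R).
  exact: mulrl_measurable.
pose pf : {measure set (measurableTypeR R) -> \bar R} :=
  measure_function_pushforward__canonical__measure_function_Measure
    lebesgue_measure mc.
pose m := mscale (NngNum (ltW c0)) pf.
transitivity (\int[m]_x f x)%E.
  by apply: eq_measure_integral => A mA _; exact: lebesgue_measure_scale.
rewrite ge0_integral_mscale//=; congr (_ * _)%E.
by rewrite ge0_integral_pushforward.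
Qed.

Lemma measurable_scale_tuple (R : realType) (n : nat) (c : R) :
  measurable_fun setT (@scale_tuple R n c).
Proof.
apply/measurable_fun_tnthP => i.
rewrite (_ : _ \o _ = ( *%R c : measurableTypeR R -> measurableTypeR R)
    \o ((@tnth _ _)^~ i)); last first.
  by apply/funext => x /=; rewrite tnth_mktuple.
apply: measurableT_comp; first exact: mulrl_measurable.
exact: measurable_tnth.
Qed.

Lemma scale_tuple_uncurry (R : realType) (n : nat) (c z : R) (y : n.-tuple R) :
  scale_tuple c (tuple_uncurry (z, y)) = tuple_uncurry (c * z, scale_tuple c y).
Proof.
apply: eq_from_tnth => i; rewrite tnth_mktuple.
have [j ->|->] := unliftP ord0 i; last by rewrite !tnth0.
by rewrite !tnthS tnth_mktuple.
Qed.

(** Induction on the dimension: substituting c z for the first coordinate gives one factor [c], and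
    the sections give the remaining power. *)
Lemma lebesgue_tuple_scale (R : realType) (n : nat) (c : R)
    (A : set (n.-tuple R)) : 0 < c -> measurable A ->
  lebesgue_tuple R n A =
  ((c ^+ n)%:E * lebesgue_tuple R n (@scale_tuple R n c @^-1` A))%E.
Proof.
move=> c0; elim: n A => [|n IH] A mA.
  rewrite expr0 mul1e; congr (lebesgue_tuple R 0 _).
  apply/seteqP; split=> x /=;
    by rewrite (_ : scale_tuple c x = x) // [LHS]tuple0 [RHS]tuple0.
have mcA : measurable (@scale_tuple R n.+1 c @^-1` A).
  by rewrite -[X in measurable X]setTI; exact: measurable_scale_tuple.
rewrite lebesgue_tupleS (ge0_integral_scale c0)//; last first.
  exact: measurable_fun_tuple_section.
rewrite lebesgue_tupleS.
under eq_integral => z _.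
  rewrite (IH _ (measurable_tuple_section (c * z) mA)).
  rewrite (_ : _ @^-1` _ = [set y | (@scale_tuple R n.+1 c @^-1` A)
      (tuple_uncurry (z, y))]); last first.
    by apply/seteqP; split=> y /=; rewrite scale_tuple_uncurry.
  over.
rewrite exprS EFinM -muleA; congr (_ * _)%E.
rewrite ge0_integralZl ?lee_fin ?exprn_ge0 1?ltW//.
exact: measurable_fun_tuple_section mcA.
Qed.

Lemma measurable_fun_prod_tnth (R : realType) (n : nat) (g : R -> R) :
  measurable_fun setT (g : measurableTypeR R -> measurableTypeR R) ->
  measurable_fun setT (fun x : n.-tuple R => \prod_(i < n) g (tnth x i)).
Proof.
move=> mg; apply: measurable_prod => i _.
apply: measurableT_comp mg _; exact: measurable_tnth.
Qed.

(** Tonelli's theorem, one coordinate at a time: this is how independence under a product weight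
    enters. *)
Lemma integral_prod_tnth (R : realType) (n : nat) (g : R -> R) (I : R) :
  measurable_fun setT (g : measurableTypeR R -> measurableTypeR R) ->
  (forall z, 0 <= g z) ->
  (\int[lebesgue_measure]_z (g z)%:E = I%:E)%E ->
  (\int[lebesgue_tuple R n]_x (\prod_(i < n) g (tnth x i))%:E = (I ^+ n)%:E)%E.
Proof.
move=> mg g0 gI; elim: n => [|n IH].
  rewrite /= expr0 (eq_integral (cst 1%E)) ?integral_cst// => [|x _].
    by rewrite /= diracE in_setT mul1e.
  by rewrite big_ord0.
rewrite ge0_integral_lebesgue_tupleS; last 2 first.
- by apply/measurable_EFinP; exact: measurable_fun_prod_tnth.
- by move=> x; rewrite lee_fin prodr_ge0.
under eq_integral => z _.
  under eq_integral => y _.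
    rewrite big_ord_recl tnth0.
    under eq_bigr do rewrite tnthS.
    rewrite EFinM /=.
    over.
  rewrite ge0_integralZl//; last first.
  - by rewrite lee_fin.
  - by move=> y _; rewrite lee_fin prodr_ge0.
  - by apply/measurable_EFinP; exact: measurable_fun_prod_tnth.
  rewrite IH.
  over.
rewrite ge0_integralZr//.
- by rewrite gI -EFinM exprS.
- exact/measurable_EFinP.
- by move=> z _; rewrite lee_fin.
(* Pulling out the constant [I ^+ n] requires its sign, read off from [I] being the integral of a
   nonnegative function. *)
- have /= := @integral_ge0 _ _ _ lebesgue_measure setT (fun z : measurableTypeR R => (g z)%:E).
  rewrite gI !lee_fin => h; rewrite exprn_ge0//; apply: h => z _; by rewrite lee_fin.
Qed.

(** * Volumes of lp balls *)

Definition lp_sum (R : realType) (p : R) (n : nat) (x : n.-tuple R) : R :=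
  \sum_(i < n) `|tnth x i| `^ p.

Definition sq_sum (R : realType) (n : nat) (x : n.-tuple R) : R :=
  \sum_(i < n) tnth x i ^+ 2.

(** The size [r] bounds the sum of p-th powers, so the usual radius is r^(1/p), and [r = n] gives
    the ball n^(1/p) B_p^n of the theorem. *)
Definition lp_vol (R : realType) (p : R) (n : nat) (r : R) : \bar R :=
  lebesgue_tuple R n [set x | lp_sum p x <= r].

Lemma lp_sum_ge0 (R : realType) (p : R) (n : nat) (x : n.-tuple R) :
  0 <= lp_sum p x.
Proof. by apply: sumr_ge0 => i _; exact: powR_ge0. Qed.

Lemma sq_sum_ge0 (R : realType) (n : nat) (x : n.-tuple R) : 0 <= sq_sum x.
Proof. by apply: sumr_ge0 => i _; exact: sqr_ge0. Qed.

Lemma measurable_lp_sum (R : realType) (p : R) (n : nat) :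
  measurable_fun [set: n.-tuple R] (@lp_sum R p n).
Proof.
apply: measurable_sum => i.
apply: (measurableT_comp (measurable_powR p)).
apply: (measurableT_comp (@normr_measurable R setT)).
exact: measurable_tnth.
Qed.

Lemma measurable_sq_sum (R : realType) (n : nat) :
  measurable_fun [set: n.-tuple R] (@sq_sum R n).
Proof.
apply: measurable_sum => i.
by apply: measurable_funX; exact: measurable_tnth.
Qed.

Lemma measurable_lp_ball (R : realType) (p r : R) (n : nat) :
  measurable [set x : n.-tuple R | lp_sum p x <= r].
Proof.
rewrite -preimage_itvNyc -[X in measurable X]setTI.
exact: measurable_lp_sum.
Qed.

Lemma measurable_sq_sum_ge (R : realType) (n : nat) (q : R) :
  measurable [set x : n.-tuple R | q <= sq_sum x].
Proof.
rewrite -preimage_itvcy -[X in measurable X]setTI.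
exact: measurable_sq_sum.
Qed.

Lemma lp_sum_scale (R : realType) (p c : R) (n : nat) (x : n.-tuple R) :
  0 <= c -> lp_sum p (scale_tuple c x) = c `^ p * lp_sum p x.
Proof.
move=> c0; rewrite /lp_sum mulr_sumr; apply: eq_bigr => i _.
by rewrite tnth_mktuple normrM powRM// ger0_norm.
Qed.

Lemma sq_sum_scale (R : realType) (c : R) (n : nat) (x : n.-tuple R) :
  sq_sum (scale_tuple c x) = c ^+ 2 * sq_sum x.
Proof.
by rewrite /sq_sum mulr_sumr; apply: eq_bigr => i _; rewrite tnth_mktuple exprMn.
Qed.

Lemma lp_sum_cons (R : realType) (p z : R) (n : nat) (y : n.-tuple R) :
  lp_sum p (tuple_uncurry (z, y)) = `|z| `^ p + lp_sum p y.
Proof.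
rewrite /lp_sum big_ord_recl tnth0; congr (_ + _).
by apply: eq_bigr => i _; rewrite tnthS.
Qed.

Lemma sq_sum_cons (R : realType) (z : R) (n : nat) (y : n.-tuple R) :
  sq_sum (tuple_uncurry (z, y)) = z ^+ 2 + sq_sum y.
Proof.
rewrite /sq_sum big_ord_recl tnth0; congr (_ + _).
by apply: eq_bigr => i _; rewrite tnthS.
Qed.

Lemma lp_vol_scale (R : realType) (p c r : R) (n : nat) : 0 < c ->
  lp_vol p n (c `^ p * r) = ((c ^+ n)%:E * lp_vol p n r)%E.
Proof.
move=> c0; rewrite {1}/lp_vol (lebesgue_tuple_scale c0); last first.
  exact: measurable_lp_ball.
congr (_ * lebesgue_tuple R n _)%E; apply/seteqP; split=> x /=;
  by rewrite lp_sum_scale ?(ltW c0)// ler_pM2l ?powR_gt0.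
Qed.

Lemma le_lp_vol (R : realType) (p r1 r2 : R) (n : nat) : r1 <= r2 ->
  (lp_vol p n r1 <= lp_vol p n r2)%E.
Proof.
move=> r12; apply: le_measure; rewrite ?inE; try exact: measurable_lp_ball.
by move=> x /= /le_trans; exact.
Qed.

Lemma norm_le_lp (R : realType) (p z r : R) : 0 < p -> 0 <= r ->
  `|z| `^ p <= r -> `|z| <= r `^ p^-1.
Proof.
move=> p0 r0 zr.
rewrite -[leLHS](@powRr1 _ `|z|)// -(@mulfV _ p) ?gt_eqF// powRrM.
by rewrite ge0_ler_powR ?invr_ge0 ?(ltW p0)// nnegrE powR_ge0.
Qed.

Lemma lp_ler (R : realType) (p z M : R) : 0 <= p -> 0 <= M ->
  `|z| <= M -> `|z| `^ p <= M `^ p.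
Proof. by move=> p0 M0 zM; rewrite ge0_ler_powR// nnegrE. Qed.

Lemma powRK (R : realType) (p r : R) : p != 0 -> 0 <= r ->
  (r `^ p^-1) `^ p = r.
Proof. by move=> p0 r0; rewrite -powRrM mulVf// powRr1. Qed.

Lemma tnth_lp_sum (R : realType) (p : R) (n : nat) (x : n.-tuple R) (i : 'I_n) :
  `|tnth x i| `^ p <= lp_sum p x.
Proof.
rewrite /lp_sum (bigD1 i)//= lerDl; apply: sumr_ge0 => j _; exact: powR_ge0.
Qed.

(** The ball lies in the cube [-M, M]^n with M = r^(1/p). *)
Lemma lp_vol_lty (R : realType) (p r : R) (n : nat) : 0 < p -> 0 <= r ->
  (lp_vol p n r < +oo)%E.
Proof.
move=> p0 r0; pose M := r `^ p^-1.
apply: (@le_lt_trans _ _ (lebesgue_tuple R n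
    [set t | forall i, `[- M, M]%classic (tnth t i)])).
  apply: le_measure; rewrite ?inE; first exact: measurable_lp_ball.
    rewrite (_ : mkset _ =
    \bigcap_(i in [set: 'I_n]) ((@tnth _ R)^~ i @^-1` `[- M, M]%classic)).
      apply: fin_bigcap_measurable => // i _.
      by rewrite -[X in measurable X]setTI; exact: measurable_tnth.
    by apply/seteqP; split=> t h i; [move=> _|]; exact: h.
  move=> x /= Sx i; rewrite in_itv/= -ler_norml.
  by apply: norm_le_lp => //; exact: le_trans (tnth_lp_sum _ _ _) Sx.
rewrite (@lebesgue_tuple_box R n (fun=> `[- M, M]%classic)) => [|i //].
rewrite (eq_bigr (fun=> (M - - M)%:E)); last first.
  move=> i _; rewrite lebesgue_measure_itv/= lte_fin.
  have M0 : 0 <= M by exact: powR_ge0.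
  by case: ltP => h; rewrite -?EFinN -?EFinD//; congr EFin; lra.
by rewrite prodEFin ltry.
Qed.

(** The first coordinate ranges over [-M, M] with M = r^(1/p), and each section lies in the
    lower-dimensional ball with the same [r]. The lower bound uses this to pass from dimension n - 1
    to the normalising volume in dimension n. *)
Lemma lp_volS_le (R : realType) (p r : R) (n : nat) : 0 < p -> 0 <= r ->
  (lp_vol p n.+1 r <= (2 * r `^ p^-1)%:E * lp_vol p n r)%E.
Proof.
move=> p0 r0; pose M := r `^ p^-1; have M0 : 0 <= M by exact: powR_ge0.
rewrite {1}/lp_vol lebesgue_tupleS.
have -> : ((2 * M)%:E * lp_vol p n r =
    \int[lebesgue_measure]_(z in `[(- M)%R, M]) lp_vol p n r)%E.
  rewrite integral_cst//= muleC lebesgue_measure_itv/= lte_fin; congr (_ * _)%E.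
  by case: ltP => h; rewrite -?EFinN -?EFinD; congr EFin; lra.
rewrite [leRHS]integral_mkcond; apply: ge0_le_integral => //.
- by apply: measurable_fun_tuple_section; exact: measurable_lp_ball.
- apply/measurable_restrict => //=; exact: measurable_itv.
move=> z _; rewrite patchE; case: ifPn => [_|].
  apply: le_measure; rewrite ?inE.
  + exact: (measurable_tuple_section z (@measurable_lp_ball R p r n.+1)).
  + exact: measurable_lp_ball.
  move=> y /=; rewrite lp_sum_cons; apply: le_trans.
  by rewrite lerDr powR_ge0.
rewrite notin_setE/= in_itv/= -ler_norml => zM.
rewrite (_ : [set y | _] = set0) ?measure0//.
apply/seteqP; split=> // y /=; rewrite lp_sum_cons => h.
apply: zM; apply: norm_le_lp => //.
by apply: le_trans h; rewrite lerDl lp_sum_ge0.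
Qed.

(** * Truncated p-Gaussian weights *)

(** Markov's inequality for volumes: the indicator of [A] is dominated by a multiple of a product
    weight, whose integral factorises. *)
Lemma lebesgue_tuple_le_prod (R : realType) (n : nat) (A : set (n.-tuple R))
    (g : R -> R) (I c : R) : measurable A ->
  measurable_fun setT (g : measurableTypeR R -> measurableTypeR R) ->
  (forall z, 0 <= g z) -> (\int[lebesgue_measure]_z (g z)%:E = I%:E)%E ->
  0 <= c -> (forall x, A x -> 1 <= c * \prod_(i < n) g (tnth x i)) ->
  (lebesgue_tuple R n A <= (c * I ^+ n)%:E)%E.
Proof.
move=> mA mg g0 gI c0 Ag.
rewrite EFinM -(@integral_prod_tnth R n g I mg g0 gI).
rewrite -ge0_integralZl//; last 2 first.
- by apply/measurable_EFinP; exact: measurable_fun_prod_tnth.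
- by move=> x _; rewrite lee_fin prodr_ge0.
have -> : lebesgue_tuple R n A = (\int[lebesgue_tuple R n]_x (\1_A x)%:E)%E.
  by rewrite integral_indic// setIT.
apply: ge0_le_integral => //.
- by apply/measurable_EFinP; exact: measurable_indic.
- apply: measurable_funeM.
  by apply/measurable_EFinP; exact: measurable_fun_prod_tnth.
move=> x _; rewrite -EFinM lee_fin indicE.
have [/set_mem Ax|_] := boolP (x \in A); first exact: Ag.
by rewrite mulr_ge0// prodr_ge0.
Qed.

Lemma integral_oneDsqr_lty (R : realType) :
  (\int[lebesgue_measure]_z ((oneDsqr z)^-1 : R)%:E < +oo)%E.
Proof.
rewrite (@ge0_symfun_integralT _ (fun z : R => (oneDsqr z)^-1)).
- by rewrite -set_itvcy integral0y_oneDsqr -EFinM ltry.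
- by move=> z; rewrite invr_ge0 (le_trans ler01 (oneDsqr_ge1 _)).
- exact: continuous_oneDsqrV.
- by move=> z; rewrite /= /oneDsqr sqrrN.
Qed.

Lemma ge_powR_sub1 (R : realType) (p z : R) : 1 <= p -> 0 <= z ->
  z - 1 <= z `^ p.
Proof.
move=> p1 z0; have [z1|z1] := leP 1 z.
  by apply: le_trans (le1r_powR z1 p1); lra.
by apply: le_trans (powR_ge0 _ _); lra.
Qed.

(** As |z|^p >= |z| - 1, the exponential is at most e^c e^(-c|z|), and the Taylor term of degree 4
    of e^(c|z|) absorbs z^2 (1 + z^2) <= 2 (1 + z^4). What remains is a multiple of the integrable
    function 1 / (1 + z^2). *)
Lemma sqr_expRN_le (R : realType) (p c z : R) : 1 <= p -> 0 < c ->
  z ^+ 2 * expR (- (c * `|z| `^ p)) <=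
  2 * (1 + 24 / c ^+ 4) * expR c * (oneDsqr z)^-1.
Proof.
move=> p1 c0.
have o0 : 0 < oneDsqr z by rewrite (lt_le_trans ltr01) ?oneDsqr_ge1.
rewrite ler_pdivlMr//.
have h1 : expR (- (c * `|z| `^ p)) <= expR c * expR (- (c * `|z|)).
  rewrite -expRD ler_expR.
  have := ge_powR_sub1 p1 (normr_ge0 z); rewrite -(ler_pM2l c0); lra.
have h2 : z ^+ 2 * oneDsqr z <= 2 * (1 + 24 / c ^+ 4) * expR (c * `|z|).
  have cz : 0 <= c * `|z| by rewrite mulr_ge0// ltW.
  have := expR_ge1Dxn 3 cz; rewrite (_ : (4`!)%:R = 24 :> R)//.
  rewrite exprMn (_ : `|z| ^+ 4 = z ^+ 4); last first.
    by rewrite -normrX ger0_norm// exprn_even_ge0.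
  move=> e1.
  have e2 : 1 <= expR (c * `|z|).
    by rewrite -expR0 ler_expR.
  have c4 : 0 < c ^+ 4 by rewrite exprn_gt0.
  have e3 : z ^+ 4 <= 24 / c ^+ 4 * expR (c * `|z|).
    rewrite mulrAC ler_pdivlMr//.
    have : z ^+ 4 * c ^+ 4 / 24 <= expR (c * `|z|).
      by apply: le_trans e1; rewrite [_ ^+ 4 * _]mulrC lerDr ler01.
    by rewrite ler_pdivrMr// mulrC [X in _ <= X]mulrC.
  rewrite /oneDsqr.
  have : z ^+ 2 * (1 + z ^+ 2) <= 2 * (1 + z ^+ 4).
    have : 0 <= (z ^+ 2 - 1) ^+ 2 by exact: sqr_ge0.
    have : 0 <= z ^+ 4 by rewrite exprn_even_ge0.
    nra.
  move=> /le_trans; apply; rewrite -mulrA ler_pM2l// mulrDl mul1r.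
  exact: lerD.
apply: (@le_trans _ _ (z ^+ 2 * oneDsqr z * (expR c * expR (- (c * `|z|))))).
  rewrite mulrAC ler_wpM2l// mulr_ge0 ?sqr_ge0//; exact: ltW.
apply: (@le_trans _ _ (2 * (1 + 24 / c ^+ 4) * expR (c * `|z|) * (expR c * expR (- (c * `|z|))))).
  by rewrite ler_wpM2r// mulr_ge0// expR_ge0.
rewrite -!mulrA [expR (c * _) * _]mulrCA -expRD subrr expR0 mulr1 //.
Qed.

Lemma integral_sqr_expRN (R : realType) (p c : R) : 1 <= p -> 0 < c ->
  exists2 K : R, 0 <= K &
  (\int[lebesgue_measure]_z (z ^+ 2 * expR (- (c * `|z| `^ p)))%:E = K%:E)%E.
Proof.
move=> p1 c0.
set I := (\int[_]_z _)%E.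
have I0 : (0 <= I)%E.
  apply: integral_ge0 => z _; rewrite lee_fin mulr_ge0 ?expR_ge0//.
  exact: sqr_ge0.
have Ioo : (I < +oo)%E.
  pose D := 2 * (1 + 24 / c ^+ 4) * expR c.
  have D0 : 0 <= D.
    by rewrite /D !mulr_ge0 ?expR_ge0// addr_ge0// divr_ge0// exprn_ge0// ltW.
  apply: (@le_lt_trans _ _ (\int[lebesgue_measure]_z (D%:E * ((oneDsqr z)^-1 : R)%:E))%E).
    apply: ge0_le_integral => //.
    - move=> z _; rewrite lee_fin mulr_ge0 ?expR_ge0//.
      exact: sqr_ge0.
    - apply/measurable_EFinP; apply: measurable_funM.
        exact: measurable_funX.
      apply: measurableT_comp => //; apply: measurableT_comp => //.
      apply: measurable_funM => //.
      by apply: (measurableT_comp (measurable_powR p)); exact: normr_measurable.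
    - apply: measurable_funeM; apply/measurable_EFinP.
      by apply: continuous_measurable_fun; exact: continuous_oneDsqrV.
    - by move=> z _; rewrite -EFinM lee_fin; exact: sqr_expRN_le.
  rewrite ge0_integralZl//.
  - by rewrite lte_mul_pinfty// integral_oneDsqr_lty.
  - apply/measurable_EFinP.
    by apply: continuous_measurable_fun; exact: continuous_oneDsqrV.
exists (fine I); first exact: fine_ge0.
by rewrite fineK// ge0_fin_numE.
Qed.

(** The unnormalised p-Gaussian weight, cut off at [M]. With M = n^(1/p) the cut loses nothing on {S
    <= n}, and it bounds S on the support, so that slicing by unit layers of S gives a finite
    sum. *)
Definition trunc_density (R : realType) (p M z : R) : R :=
  \1_(`[- M, M]%classic : set R) z * expR (- (`|z| `^ p / p)).

Definition trunc_mass (R : realType) (p M : R) : R :=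
  fine (\int[lebesgue_measure]_z (trunc_density p M z)%:E)%E.

Lemma trunc_density_ge0 (R : realType) (p M z : R) : 0 <= trunc_density p M z.
Proof. by rewrite mulr_ge0// expR_ge0. Qed.

Lemma trunc_densityE (R : realType) (p M z : R) : `|z| <= M ->
  trunc_density p M z = expR (- (`|z| `^ p / p)).
Proof.
by rewrite ler_norml => zM; rewrite /trunc_density indicE mem_set ?mul1r.
Qed.

Lemma trunc_density0 (R : realType) (p M z : R) : M < `|z| ->
  trunc_density p M z = 0.
Proof.
rewrite ltNge ler_norml => zM; rewrite /trunc_density indicE memNset ?mul0r//.
by rewrite /= in_itv/=; exact/negP.
Qed.

Lemma measurable_expN_powR (R : realType) (c p : R) : measurable_fun setT
  (fun z : measurableTypeR R => expR (- (c * `|z| `^ p))).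
Proof.
apply: measurableT_comp => //; apply: measurableT_comp => //.
apply: measurable_funM => //.
by apply: (measurableT_comp (measurable_powR p)); exact: normr_measurable.
Qed.

Lemma measurable_trunc_density (R : realType) (p M : R) :
  measurable_fun setT (trunc_density p M : measurableTypeR R -> R).
Proof.
apply: measurable_funM; first exact: measurable_indic.
have := measurable_expN_powR p^-1 p.
by apply: eq_measurable_fun => z _; rewrite mulrC.
Qed.

Lemma integral_trunc_density (R : realType) (p M : R) : 0 < p ->
  (\int[lebesgue_measure]_z (trunc_density p M z)%:E = (trunc_mass p M)%:E)%E.
Proof.
move=> p0; rewrite /trunc_mass fineK// ge0_fin_numE; last first.
  by apply: integral_ge0 => z _; rewrite lee_fin trunc_density_ge0.
apply: (@le_lt_trans _ _
    (\int[lebesgue_measure]_z (\1_(`[- M, M]%classic : set R) z)%:E)%E).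
  apply: ge0_le_integral => //.
  - by move=> z _; rewrite lee_fin trunc_density_ge0.
  - by apply/measurable_EFinP; exact: measurable_trunc_density.
  - by apply/measurable_EFinP; exact: measurable_indic.
  - move=> z _; rewrite lee_fin ler_piMr// -expR0 ler_expR oppr_le0.
    by rewrite divr_ge0 ?powR_ge0 ?ltW.
rewrite integral_indic//= setIT lebesgue_measure_itv/=.
by case: ifP => _; rewrite -?EFinN -?EFinD ltry.
Qed.

(** On [0, 1] the weight is at least e^(-1/p) >= e^(-1). A bound independent of [M] turns additive
    errors on the mass into relative ones. *)
Lemma trunc_mass_ge (R : realType) (p M : R) : 1 <= p -> 1 <= M ->
  expR (- 1) <= trunc_mass p M.
Proof.
move=> p1 M1; have p0 : 0 < p by apply: lt_le_trans p1.
rewrite -lee_fin -integral_trunc_density//.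
have -> : (expR (- 1) : R)%:E = (\int[lebesgue_measure]_z
    ((expR (- 1) : R)%:E * (\1_(`[0%R, 1%R]%classic : set R) z)%:E))%E.
  rewrite ge0_integralZl ?lee_fin ?expR_ge0//; last first.
    by apply/measurable_EFinP; exact: measurable_indic.
  rewrite integral_indic//= setIT lebesgue_measure_itv/= lte_fin ltr01.
  by rewrite oppr0 adde0 mule1.
apply: ge0_le_integral => //.
- by apply: measurable_funeM; apply/measurable_EFinP; exact: measurable_indic.
- by apply/measurable_EFinP; exact: measurable_trunc_density.
move=> z _; rewrite -EFinM lee_fin indicE.
have [/set_mem|_] := boolP (z \in _); last by rewrite mulr0 trunc_density_ge0.
rewrite /= in_itv/= => /andP[z0 z1].
rewrite mulr1 trunc_densityE ?ger0_norm//; last exact: le_trans M1.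
rewrite ler_expR lerN2 ler_pdivrMr// mul1r.
apply: le_trans p1; have -> : 1 = 1 `^ p by rewrite powR1.
by rewrite ge0_ler_powR ?(ltW p0)// nnegrE.
Qed.

Lemma prod_trunc_densityE (R : realType) (p M : R) (n : nat) (x : n.-tuple R) :
  (forall i, `|tnth x i| <= M) ->
  \prod_(i < n) trunc_density p M (tnth x i) = expR (- (lp_sum p x / p)).
Proof.
move=> xM; rewrite /lp_sum mulr_suml -sumrN expR_sum.
by apply: eq_bigr => i _; rewrite trunc_densityE.
Qed.

(** On the support every |x_i|^p is at most n, hence S(x) <= k n. If j is the integer part of S(x),
    the weight is at most e^(-j/p) and x lies in {S <= j + 1}, so the term of index j alone
    suffices. *)
Lemma prod_trunc_density_le (R : realType) (p : R) (k n : nat)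
    (x : k.-tuple R) : 0 < p ->
  \prod_(i < k) trunc_density p (n%:R `^ p^-1) (tnth x i) <=
  \sum_(j < (k * n).+1) expR (- (j%:R / p)) *
    \1_[set x : k.-tuple R | lp_sum p x <= j.+1%:R] x.
Proof.
move=> p0; set M := _ `^ p^-1.
have [/forallP xM|] := boolP [forall i, `|tnth x i| <= M]; last first.
  rewrite negb_forall => /existsP[i]; rewrite -ltNge => Mx.
  rewrite (bigD1 i)//= trunc_density0// mul0r.
  by apply: sumr_ge0 => j _; rewrite mulr_ge0 ?expR_ge0.
rewrite prod_trunc_densityE//.
have S0 := lp_sum_ge0 p x.
have Skn : lp_sum p x <= (k * n)%:R.
  rewrite natrM mulr_natl -[X in _ *+ X]card_ord -sumr_const.
  apply: ler_sum => i _; rewrite -[leRHS](@powRK R p)// ?gt_eqF//.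
  by apply: lp_ler => //; rewrite ?(ltW p0)// powR_ge0.
have /andP[jS Sj] := truncn_itv S0.
have jkn : (Num.truncn (lp_sum p x) < (k * n).+1)%N.
  by rewrite ltnS -(ler_nat R); exact: le_trans Skn.
rewrite (bigD1 (Ordinal jkn))//= indicE mem_set/=; last exact: ltW.
rewrite mulr1 -[leLHS]addr0 lerD//.
  by rewrite ler_expR lerN2 ler_pM2r ?invr_gt0.
by apply: sumr_ge0 => j _; rewrite mulr_ge0 ?expR_ge0.
Qed.

(* [exp(-u/p) u^(k/p)] is largest at [u = k]; volumes scale like [u^(k/p)]. *)
Lemma expR_lp_vol_le (R : realType) (p u : R) (k : nat) : 0 < p -> 0 < u ->
  (0 < k)%N ->
  ((expR (- (u / p)))%:E * lp_vol p k u <=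
   (expR (- (k%:R / p)))%:E * lp_vol p k k%:R)%E.
Proof.
move=> p0 u0 k0; have k0' : 0 < k%:R :> R by rewrite ltr0n.
have c0 : 0 < (u / k%:R) `^ p^-1 by rewrite powR_gt0// divr_gt0.
have -> : u = ((u / k%:R) `^ p^-1) `^ p * k%:R.
  by rewrite powRK ?gt_eqF// ?divfK ?gt_eqF// divr_ge0// ltW.
rewrite lp_vol_scale// powRK ?gt_eqF// ?divr_ge0 ?(ltW u0)// divfK ?gt_eqF//.
rewrite muleA -EFinM lee_wpmul2r//.
rewrite lee_fin -powR_mulrn ?powR_ge0// -powRrM.
have uk : u / k%:R <= expR (u / k%:R - 1).
  by apply: le_trans (expR_ge1Dx _); lra.
have h : (u / k%:R) `^ (p^-1 * k%:R) <= expR ((u / k%:R - 1) * (p^-1 * k%:R)).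
  rewrite expRM ge0_ler_powR ?nnegrE ?mulr_ge0 ?invr_ge0 ?(ltW p0)//.
  exact: ltW.
apply: (le_trans (ler_wpM2l (expR_ge0 _) h)).
rewrite -expRD ler_expR le_eqVlt; apply/orP; left; apply/eqP.
by field; rewrite !gt_eqF.
Qed.

(** Integrating the layer bound, each of the k n + 1 layers contributes at most e^((1 - k)/p)
    V_k(k): the p-Gaussian product measure exceeds the uniform one by a polynomial factor only. *)
Lemma trunc_mass_pow (R : realType) (p : R) (k n : nat) : 1 <= p ->
  (0 < k)%N ->
  ((trunc_mass p (n%:R `^ p^-1) ^+ k)%:E <=
   ((k * n).+1%:R * expR ((1 - k%:R) / p))%:E * lp_vol p k k%:R)%E.
Proof.
move=> p1 k0; have p0 : 0 < p by apply: lt_le_trans p1.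
rewrite -(@integral_prod_tnth R k (trunc_density p (n%:R `^ p^-1))); last 3 first.
- exact: measurable_trunc_density.
- exact: trunc_density_ge0.
- exact: integral_trunc_density.
apply: (@le_trans _ _ (\int[lebesgue_tuple R k]_x
    \sum_(j < (k * n).+1) ((expR (- (j%:R / p)))%:E *
    (\1_[set x : k.-tuple R | (lp_sum p x <= j.+1%:R)%R] x)%:E))%E).
  apply: ge0_le_integral => //.
  - by move=> x _; rewrite lee_fin prodr_ge0// => i _; exact: trunc_density_ge0.
  - apply/measurable_EFinP; apply: measurable_fun_prod_tnth.
    exact: measurable_trunc_density.
  - apply: emeasurable_sum => j; apply: measurable_funeM.
    by apply/measurable_EFinP; apply: measurable_indic; exact: measurable_lp_ball.
  - move=> x _; under [X in (_ <= X)%E]eq_bigr do rewrite -EFinM.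
    by rewrite sumEFin lee_fin prod_trunc_density_le.
rewrite ge0_integral_sum//; last first.
  move=> j; apply: measurable_funeM.
  by apply/measurable_EFinP; apply: measurable_indic; exact: measurable_lp_ball.
have v0 : (0 <= lp_vol p k k%:R)%E by exact: measure_ge0.
have vfin : (lp_vol p k k%:R \is a fin_num)%E.
  by rewrite ge0_fin_numE// lp_vol_lty.
apply: (@le_trans _ _ (\sum_(j < (k * n).+1)
   ((expR ((1 - k%:R) / p))%:E * lp_vol p k k%:R))%E).
  apply: lee_sum => j _.
  rewrite ge0_integralZl ?lee_fin ?expR_ge0//; last first.
    by apply/measurable_EFinP; apply: measurable_indic; exact: measurable_lp_ball.
  rewrite integral_indic//; last exact: measurable_lp_ball.
  rewrite setIT -/(lp_vol p k j.+1%:R).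
  (* The weight e^(-j/p) goes with the ball of size j + 1; this shift costs e^(1/p), and
     [expR_lp_vol_le] applies with u = j + 1 > 0. *)
  have -> : - (j%:R / p) = p^-1 + - (j.+1%:R / p).
    by rewrite -natr1; field; rewrite gt_eqF.
  have -> : (1 - k%:R) / p = p^-1 + - (k%:R / p).
    by field; rewrite gt_eqF.
  rewrite !expRD !EFinM -!muleA lee_wpmul2l ?lee_fin ?expR_ge0//.
  exact: expR_lp_vol_le.
by rewrite -(fineK vfin) -EFinM sumEFin lee_fin sumr_const card_ord -[leLHS]mulr_natl mulrA.
Qed.

(** * Chernoff bound *)

(** The second branch stays a factor 1 - e below the exponent of the p-Gaussian weight, which keeps
    the decay e^(-e|z|^p/p) after tilting; the first branch makes the effect proportional to [l]. *)
Definition tilt (R : realType) (p e l z : R) : R :=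
  Num.min (l * z ^+ 2) ((1 - e) * (`|z| `^ p / p)).

Lemma measurable_tilt (R : realType) (p e l : R) :
  measurable_fun setT (tilt p e l : measurableTypeR R -> R).
Proof.
apply: measurable_minr.
  by apply: measurable_funM => //; exact: measurable_funX.
apply: measurable_funM => //; apply: measurable_funM => //.
by apply: (measurableT_comp (measurable_powR p)); exact: normr_measurable.
Qed.

Lemma tilt_ge0 (R : realType) (p e l z : R) : 0 < p -> e <= 1 -> 0 <= l ->
  0 <= tilt p e l z.
Proof.
move=> p0 e1 l0; rewrite le_min mulr_ge0 ?sqr_ge0//=.
by rewrite mulr_ge0 ?subr_ge0// divr_ge0 ?powR_ge0// ltW.
Qed.

(** Start from e^t <= 1 + t e^t, which is 1 - t <= e^(-t) multiplied by e^t. The factor t is then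
    bounded by the quadratic branch of the minimum, and the t in the exponent by the other
    branch. *)
Lemma trunc_density_tilt_le (R : realType) (p e l M z : R) :
  0 < p -> e <= 1 -> 0 <= l ->
  trunc_density p M z * expR (tilt p e l z) <=
  trunc_density p M z + l * (z ^+ 2 * expR (- (e / p * `|z| `^ p))).
Proof.
move=> p0 e1 l0.
have rhs0 : 0 <= l * (z ^+ 2 * expR (- (e / p * `|z| `^ p))).
  by rewrite mulr_ge0// mulr_ge0 ?expR_ge0 ?sqr_ge0.
have [zM|Mz] := leP `|z| M; last by rewrite trunc_density0// mul0r add0r.
rewrite trunc_densityE//.
have t0 := tilt_ge0 z p0 e1 l0.
have h1 : expR (tilt p e l z) <= 1 + tilt p e l z * expR (tilt p e l z).
  have := expR_ge1Dx (- tilt p e l z).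
  rewrite -(ler_pM2r (expR_gt0 (tilt p e l z))) -expRD addNr expR0 => h.
  by rewrite mulrDl mul1r mulNr in h; lra.
apply: (le_trans (ler_wpM2l (expR_ge0 _) h1)).
rewrite mulrDr mulr1 lerD2l.
apply: (@le_trans _ _ (expR (- (`|z| `^ p / p)) *
    (l * z ^+ 2 * expR ((1 - e) * (`|z| `^ p / p))))).
  rewrite ler_wpM2l ?expR_ge0// ler_pM ?expR_ge0//.
    by rewrite /tilt ge_min lexx.
  by rewrite ler_expR /tilt ge_min lexx orbT.
rewrite mulrCA -expRD -!mulrA.
rewrite le_eqVlt; apply/orP; left; apply/eqP; congr (_ * (_ * (_ * expR _))).
by field; rewrite gt_eqF.
Qed.

Lemma integral_tilted (R : realType) (p e l M K : R) :
  0 < p -> e <= 1 -> 0 <= l ->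
  (\int[lebesgue_measure]_z
    (z ^+ 2 * expR (- (e / p * `|z| `^ p)))%:E = K%:E)%E ->
  exists2 I : R, 0 <= I <= trunc_mass p M + l * K &
  (\int[lebesgue_measure]_z
     (trunc_density p M z * expR (tilt p e l z))%:E = I%:E)%E.
Proof.
move=> p0 e1 l0 hK; set J := (\int[_]_z (_ * expR (tilt _ _ _ _))%:E)%E.
have J0 : (0 <= J)%E.
  by apply: integral_ge0 => z _; rewrite lee_fin mulr_ge0 ?expR_ge0 ?trunc_density_ge0.
have mK : measurable_fun setT (fun z : measurableTypeR R =>
    (z ^+ 2 * expR (- (e / p * `|z| `^ p)))%:E).
  apply/measurable_EFinP; apply: measurable_funM; last exact: measurable_expN_powR.
  exact: measurable_funX.
have K0 (z : R) : (0 <= (z ^+ 2 * expR (- (e / p * `|z| `^ p)))%:E)%E.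
  by rewrite lee_fin mulr_ge0 ?expR_ge0 ?sqr_ge0.
have JK : (J <= (trunc_mass p M + l * K)%:E)%E.
  rewrite EFinD EFinM -hK -integral_trunc_density// -ge0_integralZl//.
  rewrite -ge0_integralD//; last 4 first.
  - by move=> z _; rewrite lee_fin trunc_density_ge0.
  - by apply/measurable_EFinP; exact: measurable_trunc_density.
  - by move=> z _; rewrite mule_ge0.
  - exact: measurable_funeM.
  apply: ge0_le_integral => //.
  - by move=> z _; rewrite lee_fin mulr_ge0 ?expR_ge0 ?trunc_density_ge0.
  - apply/measurable_EFinP; apply: measurable_funM.
      exact: measurable_trunc_density.
    by apply: measurableT_comp => //; exact: measurable_tilt.
  - apply: emeasurable_funD; last exact: measurable_funeM.
    by apply/measurable_EFinP; exact: measurable_trunc_density.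
  - move=> z _; rewrite -EFinM -EFinD lee_fin.
    exact: trunc_density_tilt_le.
have Jfin : J \is a fin_num.
  by rewrite ge0_fin_numE//; apply: le_lt_trans JK _; rewrite ltry.
exists (fine J); last by rewrite fineK.
by rewrite fine_ge0//= -lee_fin fineK.
Qed.

(* If some coordinate exceeds [T] it carries the whole bound alone; otherwise
   the quadratic branch of the minimum is active at every coordinate. *)
Lemma sum_tilt_ge (R : realType) (p e T : R) (n : nat) (x : n.-tuple R) :
  0 < p <= 2 -> e <= 1 -> 0 < T -> T ^+ 2 <= sq_sum x ->
  (1 - e) * (T `^ p / p) <=
  \sum_(i < n) tilt p e ((1 - e) * (T `^ p / p) / T ^+ 2) (tnth x i).
Proof.
move=> /andP[p0 p2] e1 T0 Tx; set a := (1 - e) * (T `^ p / p).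
have T2 : 0 < T ^+ 2 by rewrite exprn_gt0.
have a0 : 0 <= a.
  by rewrite mulr_ge0 ?subr_ge0// divr_ge0 ?powR_ge0// ltW.
have l0 : 0 <= a / T ^+ 2 by rewrite divr_ge0// ltW.
have [/forallP xT|] := boolP [forall i, `|tnth x i| <= T]; last first.
  rewrite negb_forall => /existsP[i]; rewrite -ltNge => Tx_i.
  rewrite (bigD1 i)//= -[leLHS]addr0 lerD//; last first.
    by apply: sumr_ge0 => j _; exact: tilt_ge0.
  rewrite le_min; apply/andP; split.
    rewrite -mulrA ler_peMr// mulrC ler_pdivlMr// mul1r -(real_normK (num_real (tnth x i))).
    by rewrite ler_sqr ?nnegrE ?(ltW T0)// ltW.
  rewrite /a ler_wpM2l ?subr_ge0// ler_pM2r ?invr_gt0//.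
  by rewrite ge0_ler_powR ?nnegrE ?(ltW p0) ?(ltW T0)// ltW.
apply: (@le_trans _ _ (a / T ^+ 2 * sq_sum x)).
  by rewrite -mulrA ler_peMr// mulrC ler_pdivlMr// mul1r.
rewrite mulr_sumr; apply: ler_sum => i _; rewrite le_min lexx/=.
rewrite /a -!mulrA ler_wpM2l ?subr_ge0// mulrA [X in X <= _]mulrA.
have [->|x0] := eqVneq (tnth x i) 0.
  by rewrite expr0n/= mulr0 divr_ge0 ?powR_ge0// ltW.
have nx0 : `|tnth x i| != 0 by rewrite normr_eq0.
rewrite -(real_normK (num_real (tnth x i))).
rewrite (_ : T `^ p / p / T ^+ 2 * `|tnth x i| ^+ 2 =
  T `^ p * `|tnth x i| ^+ 2 / T ^+ 2 / p); last first.
  by field; rewrite !gt_eqF.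
(* Writing squares as y^p y^(2-p) reduces the comparison of the branches to |x_i|^(2-p) <= T^(2-p),
   which is where p <= 2 enters. *)
have D (y : R) : 0 < y -> y ^+ 2 = y `^ p * y `^ (2 - p).
  by move=> y0; rewrite -powRD ?subrKC ?powR_mulrn ?(ltW y0) ?(gt_eqF y0) ?implybT.
rewrite ler_pM2r ?invr_gt0// ler_pdivrMr// !D ?normr_gt0//.
rewrite mulrCA ler_wpM2l ?powR_ge0// ler_wpM2l ?powR_ge0//.
by rewrite ge0_ler_powR ?nnegrE ?subr_ge0 ?(ltW T0).
Qed.

(** The Chernoff bound, with a constant independent of [n], [k] and [T]. The case k = n serves the
    upper bound; the case n = k + 1 controls the remaining coordinates in the lower bound. *)
Lemma sq_sum_tail (R : realType) (p e : R) : 1 <= p <= 2 -> 0 < e <= 1 ->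
  exists2 C : R, 0 <= C & forall (n k : nat) (T : R),
  (0 < k)%N -> (k <= n <= k.+1)%N -> 0 < T ->
  (lebesgue_tuple R k
    ([set x | lp_sum p x <= n%:R]%R `&` [set x | T ^+ 2 <= sq_sum x]%R) <=
   ((k * n).+1%:R *
    expR (2 - (1 - e) * (T `^ p / p) * (1 - C * (n%:R / T ^+ 2))))%:E *
   lp_vol p k n%:R)%E.
Proof.
move=> /andP[p1 p2] /andP[e0 e1]; have p0 : 0 < p by apply: lt_le_trans p1.
have [K K0 hK] := integral_sqr_expRN p1 (divr_gt0 e0 p0).
(* [K] is the integral of z^2 e^(-e|z|^p/p), and the factor e^1 is the inverse of the lower bound on
   the truncated mass. *)
exists (K * expR 1); first by rewrite mulr_ge0 ?expR_ge0.
move=> n k T k0 /andP[kn nk] T0.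
have n1 : 1 <= n%:R :> R by rewrite ler1n (leq_trans k0).
set a := (1 - e) * (T `^ p / p).
have a0 : 0 <= a.
  by rewrite mulr_ge0 ?subr_ge0// divr_ge0 ?powR_ge0// ltW.
pose l := a / T ^+ 2.
have l0 : 0 <= l by rewrite divr_ge0// exprn_ge0// ltW.
pose M := n%:R `^ p^-1.
have M1 : 1 <= M.
  by rewrite -[leLHS](powRr0 n%:R) ler_powR// invr_ge0 ltW.
have [I /andP[I0 IK] hI] := integral_tilted M p0 e1 l0 hK.
pose Z := trunc_mass p M.
have Z0 : 0 < Z by apply: lt_le_trans (expR_gt0 _) (trunc_mass_ge p1 M1).
(* I <= Z + l K <= Z (1 + l K e^1), as Z e^1 >= 1: each coordinate pays a relative factor exp(l K
   e^1) for the tilt. *)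
have IZ : I <= Z * expR (l * (K * expR 1)).
  apply: (le_trans IK); apply: (@le_trans _ _ (Z * (1 + l * (K * expR 1)))).
    rewrite mulrDr mulr1 lerD2l mulrCA ler_wpM2l//.
    have ZK := ler_wpM2r (expR_ge0 1) (trunc_mass_ge p1 M1).
    rewrite -expRD addNr expR0 -/Z in ZK.
    by rewrite mulrCA ler_peMr.
  by rewrite ler_wpM2l ?(ltW Z0)// expR_ge1Dx.
have Ik : I ^+ k <= Z ^+ k * expR (n%:R * l * (K * expR 1)).
  apply: (@le_trans _ _ ((Z * expR (l * (K * expR 1))) ^+ k)).
    by rewrite lerXn2r ?nnegrE// mulr_ge0 ?expR_ge0// ltW.
  rewrite exprMn ler_wpM2l ?exprn_ge0 ?(ltW Z0)// -expRM_natl ler_expR.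
  by rewrite -[leRHS]mulrA ler_wpM2r ?ler_nat// mulr_ge0// mulr_ge0// expR_ge0.
(* On the set to be measured, e^((n - S)/p) >= 1 and the tilts sum to at least [a], so [c] times the
   tilted product weight is at least 1. *)
pose c := expR (n%:R / p - a).
have Zk := @trunc_mass_pow R p k n p1 k0.
apply: (@le_trans _ _ ((c * I ^+ k)%:E)).
  apply: (lebesgue_tuple_le_prod _ _ _ hI).
  - apply: measurableI; first exact: measurable_lp_ball.
    exact: measurable_sq_sum_ge.
  - apply: measurable_funM; first exact: measurable_trunc_density.
    by apply: measurableT_comp => //; exact: measurable_tilt.
  - by move=> z; rewrite mulr_ge0 ?expR_ge0 ?trunc_density_ge0.
  - exact: expR_ge0.
  move=> x /= [xn Tx]; rewrite big_split/= -expR_sum prod_trunc_densityE; last first.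
    move=> i; apply: norm_le_lp => //.
    exact: le_trans (tnth_lp_sum p x i) xn.
  rewrite /c -!expRD -[leLHS]expR0 ler_expR.
  have p02 : 0 < p <= 2 by rewrite p0.
  have := sum_tilt_ge p02 e1 T0 Tx; rewrite -/a -/l => h.
  have : lp_sum p x / p <= n%:R / p by rewrite ler_pM2r// invr_gt0.
  lra.
apply: (@le_trans _ _ ((c * expR (n%:R * l * (K * expR 1)))%:E * (Z ^+ k)%:E)%E).
  by rewrite -EFinM lee_fin -[leRHS]mulrA ler_wpM2l ?expR_ge0// [leRHS]mulrC.
apply: (@le_trans _ _ ((c * expR (n%:R * l * (K * expR 1)))%:E *
   (((k * n).+1%:R * expR ((1 - k%:R) / p))%:E * lp_vol p k n%:R))%E).
  rewrite lee_wpmul2l ?lee_fin ?mulr_ge0 ?expR_ge0//; apply: (le_trans Zk).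
  by rewrite lee_wpmul2l ?lee_fin ?mulr_ge0 ?expR_ge0// le_lp_vol// ler_nat.
rewrite muleA -EFinM lee_wpmul2r//.
rewrite lee_fin mulrCA ler_wpM2l// /c -!expRD ler_expR.
(* The remainder (n - k + 1) / p is at most 2 because n <= k + 1 and p >= 1; this is the 2 in the
   exponent of the statement. *)
have -> : n%:R / p - a + n%:R * l * (K * expR 1) + (1 - k%:R) / p =
  (n%:R - k%:R + 1) / p - a * (1 - K * expR 1 * (n%:R / T ^+ 2)).
  by rewrite /l; field; rewrite !gt_eqF// exprn_gt0.
rewrite lerD2r ler_pdivrMr//.
have : n%:R <= k%:R + 1 :> R by rewrite natr1 ler_nat.
by move=> h; nra.
Qed.

(** * Lower bound *)

(** A null volume would make the k-th power of the truncated mass nonpositive by [trunc_mass_pow],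
    although that mass is at least e^(-1). *)
Lemma lp_vol_gt0 (R : realType) (p : R) (k n : nat) : 1 <= p ->
  (0 < k <= n)%N -> (0 < lp_vol p k n%:R)%E.
Proof.
move=> p1 /andP[k0 kn]; have p0 : 0 < p by apply: lt_le_trans p1.
apply: (@lt_le_trans _ _ (lp_vol p k k%:R)); last by rewrite le_lp_vol// ler_nat.
have k1 : 1 <= k%:R :> R by rewrite ler1n.
have M1 : 1 <= k%:R `^ p^-1.
  by rewrite -[leLHS](powRr0 k%:R) ler_powR// invr_ge0 ltW.
have Z0 := lt_le_trans (expR_gt0 _) (trunc_mass_ge p1 M1).
have := trunc_mass_pow k p1 k0; apply: contraPT; rewrite -leNgt => v0.
have -> : lp_vol p k k%:R = 0%E by apply/eqP; rewrite eq_le v0 measure_ge0.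
by rewrite mule0 lee_fin leNgt exprn_gt0.
Qed.

(** With h = a / n, 1 / (1 - h) = 1 + h / (1 - h) <= e^(h/(1-h)); invert and raise to the power k /
    p <= n / p. This prices the shrinking of the ball that makes room for one large coordinate. *)
Lemma powR_1B_ge (R : realType) (p a : R) (k n : nat) : 0 < p -> 0 <= a ->
  a < n%:R -> (k <= n)%N ->
  expR (- (a / p / (1 - a / n%:R))) <= ((1 - a / n%:R) `^ p^-1) ^+ k.
Proof.
move=> p0 a0 an kn.
have n0 : 0 < n%:R :> R by exact: le_lt_trans an.
set h := a / n%:R.
have h0 : 0 <= h by rewrite divr_ge0.
have h1 : 0 < 1 - h by rewrite subr_gt0 ltr_pdivrMr// mul1r.
have e1 : expR (- (h / (1 - h))) <= 1 - h.
  rewrite expRN -[leRHS]invrK lef_pV2 ?posrE ?expR_gt0 ?invr_gt0//.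
  apply: le_trans (expR_ge1Dx _).
  by rewrite le_eqVlt; apply/orP; left; apply/eqP; field; rewrite gt_eqF.
rewrite -powR_mulrn ?powR_ge0// -powRrM.
apply: (@le_trans _ _ (expR (- (h / (1 - h))) `^ (p^-1 * k%:R))); last first.
  by rewrite ge0_ler_powR ?mulr_ge0 ?invr_ge0 ?(ltW p0)// nnegrE ?expR_ge0 ?(ltW h1).
rewrite -expRM ler_expR mulNr lerN2.
have -> : a / p / (1 - h) = h / (1 - h) * (p^-1 * n%:R).
  by rewrite /h; field; rewrite !gt_eqF ?subr_gt0.
rewrite ler_wpM2l ?divr_ge0 ?(ltW h1)//.
by rewrite ler_wpM2l ?invr_ge0 ?(ltW p0)// ler_nat.
Qed.

Lemma measurable_lp_sq (R : realType) (p r a b : R) (n : nat) : measurable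
  [set x : n.-tuple R | lp_sum p x <= r /\ a <= sq_sum x <= b].
Proof.
rewrite (_ : mkset _ = [set x | lp_sum p x <= r] `&`
    (@sq_sum R n @^-1` `[a, b]%classic)); last first.
  by apply/seteqP; split=> x /=; rewrite in_itv.
apply: measurableI; first exact: measurable_lp_ball.
by rewrite -[X in measurable X]setTI; exact: measurable_sq_sum.
Qed.

(** By hypothesis at least half of the ball has Q < q. Dilating this half by c <= 1 multiplies S by
    c^p, keeps Q below q and multiplies the volume by c^k. *)
Lemma sq_sum_bulk (R : realType) (p q c : R) (k n : nat) : 0 < p -> 0 < c <= 1 ->
  (lebesgue_tuple R k
    ([set x | lp_sum p x <= n%:R]%R `&` [set x | q <= sq_sum x]%R) <=
   (2^-1)%:E * lp_vol p k n%:R)%E ->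
  ((c ^+ k / 2)%:E * lp_vol p k n%:R <=
   lebesgue_tuple R k
    [set x | lp_sum p x <= c `^ p * n%:R /\ sq_sum x <= q]%R)%E.
Proof.
move=> p0 /andP[c0 c1] tail.
rewrite (_ : mkset _ =
  [set x | lp_sum p x <= c `^ p * n%:R /\ 0 <= sq_sum x <= q]); last first.
  by apply/seteqP; split=> x /=; rewrite sq_sum_ge0.
rewrite (lebesgue_tuple_scale c0); last exact: measurable_lp_sq.
rewrite EFinM -muleA lee_wpmul2l ?lee_fin ?exprn_ge0 ?(ltW c0)//.
set B := [set x | lp_sum p x <= n%:R] in tail *.
set Q := [set x | q <= sq_sum x] in tail *.
set G := _ @^-1` _.
have mB : measurable B by exact: measurable_lp_ball.
have mQ : measurable Q by exact: measurable_sq_sum_ge.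
have mG : measurable G.
  rewrite -[X in measurable X]setTI; apply: measurable_scale_tuple => //.
  exact: measurable_lp_sq.
have : (lebesgue_tuple R k B <= lebesgue_tuple R k ((B `&` Q) `|` G))%E.
  apply: le_measure; rewrite ?inE//.
    by apply: measurableU => //; exact: measurableI.
  move=> x Bx; have [Qx|/ltW Qx] := leP q (sq_sum x); first by left.
  right; rewrite /G/= lp_sum_scale ?(ltW c0)//.
  rewrite ler_pM2l ?powR_gt0//; split=> //; rewrite sq_sum_ge0/= sq_sum_scale.
  apply: le_trans Qx; rewrite ler_piMl ?sq_sum_ge0//.
  by rewrite exprn_ile1// ltW.
move=> /le_trans/(_ (measureU2 _ _ _)) => /(_ (measurableI _ _ mB mQ) mG).
move=> /le_trans/(_ (leeD2r _ tail)).
have vfin : lp_vol p k n%:R \is a fin_num.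
  by rewrite ge0_fin_numE ?lp_vol_lty// measure_ge0.
rewrite -/(lp_vol p k n%:R) -(fineK vfin) -EFinM.
rewrite -leeBlDl// -EFinB; apply: le_trans; rewrite lee_fin; lra.
Qed.

(* One coordinate lies in [[L, L']], the others form a rescaled typical point
   of the ball of dimension [k]. *)
Lemma sq_sum_window (R : realType) (p L L' q : R) (k : nat) : 1 <= p ->
  (0 < k)%N -> 0 <= L < L' -> L' `^ p < k.+1%:R ->
  (lebesgue_tuple R k
    ([set x | lp_sum p x <= k.+1%:R]%R `&` [set x | q <= sq_sum x]%R) <=
   (2^-1)%:E * lp_vol p k k.+1%:R)%E ->
  (((L' - L) / (4 * k.+1%:R `^ p^-1) *
     expR (- (L' `^ p / p / (1 - L' `^ p / k.+1%:R))))%:E *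
    lp_vol p k.+1 k.+1%:R <=
   lebesgue_tuple R k.+1 [set x | lp_sum p x <= k.+1%:R /\
     L ^+ 2 <= sq_sum x <= L' ^+ 2 + q]%R)%E.
Proof.
move=> p1 k0 /andP[L0 LL'] L'n tail; have p0 : 0 < p by apply: lt_le_trans p1.
set n := k.+1 in L'n tail *; have n0 : 0 < n%:R :> R by rewrite ltr0n.
set h := L' `^ p / n%:R.
have h0 : 0 <= h by rewrite divr_ge0 ?powR_ge0.
have h1 : 0 < 1 - h by rewrite subr_gt0 ltr_pdivrMr// mul1r.
(* Chosen so that c^p n = n - L'^p: a coordinate of size at most L' and the dilated point together
   stay in {S <= n}. *)
pose c := (1 - h) `^ p^-1.
have c0 : 0 < c by exact: powR_gt0.
have c1 : c <= 1.
  rewrite -[leRHS](powRr0 (1 - h)) ger_powR ?invr_ge0 ?(ltW p0)// h1; lra.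
have c01 : 0 < c <= 1 by rewrite c0.
have bulk := sq_sum_bulk p0 c01 tail.
have cpn : c `^ p * n%:R = n%:R - L' `^ p.
  by rewrite /c powRK ?gt_eqF ?(ltW h1)// /h; field; rewrite gt_eqF.
set A := [set x : n.-tuple R | _].
have mA : measurable A by exact: measurable_lp_sq.
have vfin : lp_vol p k n%:R \is a fin_num.
  by rewrite ge0_fin_numE ?lp_vol_lty// measure_ge0.
have v0 : (0 <= lp_vol p k n%:R)%E by exact: measure_ge0.
have step : (((L' - L) * (c ^+ k / 2))%:E * lp_vol p k n%:R <=
    lebesgue_tuple R n A)%E.
  rewrite [leRHS]lebesgue_tupleS.
  have -> : (((L' - L) * (c ^+ k / 2))%:E * lp_vol p k n%:R =
    \int[lebesgue_measure]_(z in `[L, L']) ((c ^+ k / 2)%:E * lp_vol p k n%:R))%E.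
    rewrite integral_cst//= lebesgue_measure_itv/= lte_fin LL'.
    by rewrite -EFinB [RHS]muleC muleA -EFinM.
  rewrite [leLHS]integral_mkcond; apply: ge0_le_integral => //.
  - move=> z _; rewrite patchE; case: ifPn => // _.
    by rewrite mule_ge0// lee_fin divr_ge0// exprn_ge0// ltW.
  - apply/measurable_restrict => //=.
  - exact: measurable_fun_tuple_section.
  move=> z _; rewrite patchE; case: ifPn => [|_]; last exact: measure_ge0.
  rewrite inE/= in_itv/= => /andP[Lz zL'].
  have z0 : 0 <= z by exact: le_trans Lz.
  apply: (le_trans bulk); apply: le_measure; rewrite ?inE.
  + rewrite (_ : mkset _ =
      [set x | lp_sum p x <= c `^ p * n%:R /\ 0 <= sq_sum x <= q]).
      exact: measurable_lp_sq.
    by apply/seteqP; split=> x /=; rewrite sq_sum_ge0.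
  + exact: measurable_tuple_section.
  move=> y /=; rewrite cpn /A/= lp_sum_cons sq_sum_cons => -[Sy Qy]; split.
    have : `|z| `^ p <= L' `^ p.
      by apply: lp_ler; rewrite ?(ltW p0) ?(le_trans z0)// ger0_norm.
    lra.
  have zz : L ^+ 2 <= z ^+ 2 <= L' ^+ 2.
    by rewrite !lerXn2r ?nnegrE// (le_trans z0).
  by have := sq_sum_ge0 y; case/andP: zz; move=> *; apply/andP; split; lra.
apply: le_trans step.
have n_p : 0 < n%:R `^ p^-1 by rewrite powR_gt0.
(* The 4 is the 2 of the typical half times the 2 of the interval [-n^(1/p), n^(1/p)] in
   [lp_volS_le], which replaces V_k(n) by V_n(n). *)
apply: (@le_trans _ _ (((L' - L) / (4 * n%:R `^ p^-1) * c ^+ k)%:E *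
   ((2 * n%:R `^ p^-1)%:E * lp_vol p k n%:R))%E); last first.
  rewrite muleA -EFinM lee_wpmul2r// lee_fin le_eqVlt; apply/orP; left.
  by apply/eqP; field; rewrite gt_eqF.
have LL0 : 0 <= (L' - L) / (4 * n%:R `^ p^-1).
  by rewrite divr_ge0 ?subr_ge0 ?mulr_ge0 ?powR_ge0// ltW.
apply: (@le_trans _ _ (((L' - L) / (4 * n%:R `^ p^-1) * c ^+ k)%:E *
   lp_vol p n n%:R)%E).
  rewrite lee_wpmul2r ?measure_ge0// lee_fin ler_wpM2l//.
  by apply: powR_1B_ge => //; rewrite powR_ge0.
rewrite lee_wpmul2l ?lee_fin ?(mulr_ge0 LL0) ?exprn_ge0 ?(ltW c0)//.
exact: (lp_volS_le k p0 (ltW n0)).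
Qed.

(** * A criterion for the large deviation principle *)

Lemma limn_esup_le_near (R : realType) (u : (\bar R)^nat) (b : \bar R) :
  (\forall n \near \oo, (u n <= b)%E) -> (limn_esup u <= b)%E.
Proof.
move=> ub; apply: (@le_trans _ _ (ereal_sup (u @` [set n | (u n <= b)%E]))).
  apply: ereal_inf_lbound; exists [set n | (u n <= b)%E] => //.
by apply: ge_ereal_sup => _ [n un <-].
Qed.

Lemma limn_einf_ge_near (R : realType) (u : (\bar R)^nat) (b : \bar R) :
  (\forall n \near \oo, (b <= u n)%E) -> (b <= limn_einf u)%E.
Proof.
move=> ub; rewrite /limn_einf leeNr; apply: limn_esup_le_near.
by apply: filterS ub => n un; rewrite leeN2.
Qed.

(** Testing with reals strictly below a real minorant treats a finite and an infinite [x] alike;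
    here [x] will be an infimum of the rate function. *)
Lemma le_ereal_fin (R : realType) (x y : \bar R) : (0 <= x)%E ->
  (forall b b' : R, b < b' -> (b'%:E <= x)%E -> (b%:E <= y)%E) -> (x <= y)%E.
Proof.
case: x => [r| |//] _ h.
  apply/lee_subgt0Pr => e e0; rewrite -EFinB; apply: (h _ r) => //; lra.
rewrite leye_eq; apply/eqP/eqyP => A A0.
by apply: (h _ (A + 1)); rewrite ?leey//; lra.
Qed.

Lemma J_X_ge0 (R : realType) (p x : R) : 0 < p -> (0 <= J_X p x)%E.
Proof.
by move=> p0; rewrite /J_X; case: ifP => // _; rewrite lee_fin divr_ge0 ?powR_ge0 ?ltW.
Qed.

Lemma J_X_le (R : realType) (p a x : R) : 0 < p -> 0 <= a ->
  (J_X p x <= a%:E)%E = (0 <= x <= (p * a) `^ p^-1).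
Proof.
move=> p0 a0; rewrite /J_X; case: ifP => // x0; rewrite lee_fin ler_pdivrMr// mulrC.
have pa0 : 0 <= p * a by rewrite mulr_ge0// ltW.
rewrite -(ger0_norm x0); apply/idP/idP; first exact: norm_le_lp.
move=> h; rewrite -[leRHS](@powRK _ p)// ?gt_eqF//.
by apply: lp_ler; rewrite ?(ltW p0)// powR_ge0.
Qed.

(** The level sets are empty or segments [0, (p a)^(1/p)]; being compact they are closed, which
    yields lower semicontinuity. *)
Lemma J_X_good (R : realType) (p : R) : 0 < p -> is_good_rate_function (@J_X R p).
Proof.
move=> p0.
have cJ (a : R) : compact [set x : R | (J_X p x <= a%:E)%E].
  have [a0|a0] := leP 0 a.
    rewrite (_ : mkset _ = `[0, (p * a) `^ p^-1]%classic).
      exact: segment_compact.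
    by apply/seteqP; split=> x /=; rewrite J_X_le// in_itv.
  rewrite (_ : mkset _ = set0); first exact: compact0.
  apply/seteqP; split=> // x /= h.
  by have := le_trans (J_X_ge0 x p0) h; rewrite lee_fin leNgt a0.
split=> //; split; first by move=> x; exact: J_X_ge0.
apply/lower_semicontinuousP => a.
rewrite (_ : mkset _ = ~` [set x : R | (J_X p x <= a%:E)%E]).
  by apply: closed_openC; apply: compact_closed => //; exact: norm_hausdorff.
by apply/seteqP; split=> x /=; rewrite ltNge => /negP.
Qed.

Lemma borel_set_measurable (R : realType) (B : set R) :
  borel_set B -> measurable B.
Proof.
apply: smallest_sub; first exact: sigma_algebra_measurable.
by move=> U /open_measurable.
Qed.

Lemma lne_le_fin (R : realType) (x : \bar R) (c : R) : (0 <= x)%E ->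
  (x <= (expR c)%:E)%E -> (lne x <= c%:E)%E.
Proof.
move=> x0 xc; rewrite -[leRHS]expeRK lee_lne//=.
  by rewrite in_itv/= x0 leey.
by rewrite in_itv/= lee_fin expR_ge0 leey.
Qed.

Lemma lne_ge_fin (R : realType) (x : \bar R) (c : R) :
  ((expR c)%:E <= x)%E -> (c%:E <= lne x)%E.
Proof.
move=> xc; rewrite -[leLHS]expeRK lee_lne//=.
  by rewrite in_itv/= lee_fin expR_ge0 leey.
by rewrite in_itv/= leey andbT; apply: le_trans xc; rewrite lee_fin expR_ge0.
Qed.

Section ldp_criterion.
Context (d : measure_display) (Omega : measurableType d) (R : realType)
  (P : probability Omega R).

Lemma log_prob_le (s : nat -> R) (eta : nat -> Omega -> R) (B : set R) (n : nat)
    (b : R) : 0 < s n -> (P (eta n @^-1` B) <= (expR (- (b * s n)))%:E)%E ->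
  (log_prob P s eta B n <= - b%:E)%E.
Proof.
move=> s0 h; rewrite /log_prob.
have -> : (- b%:E = ((s n)^-1)%:E * (- (b * s n))%:E)%E.
  by rewrite -EFinM -EFinN; congr EFin; field; rewrite gt_eqF.
rewrite lee_wpmul2l ?lee_fin ?invr_ge0 ?(ltW s0)//.
exact: lne_le_fin (measure_ge0 _ _) h.
Qed.

Lemma log_prob_ge (s : nat -> R) (eta : nat -> Omega -> R) (B : set R) (n : nat)
    (b : R) : 0 < s n -> ((expR (- (b * s n)))%:E <= P (eta n @^-1` B))%E ->
  (- b%:E <= log_prob P s eta B n)%E.
Proof.
move=> s0 h; rewrite /log_prob.
have -> : (- b%:E = ((s n)^-1)%:E * (- (b * s n))%:E)%E.
  by rewrite -EFinM -EFinN; congr EFin; field; rewrite gt_eqF.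
rewrite lee_wpmul2l ?lee_fin ?invr_ge0 ?(ltW s0)//.
exact: lne_ge_fin.
Qed.

(** The rate increases on the half-line that carries [eta], so the upper bound is needed only for
    half-lines [x, +oo) and the lower bound only for open intervals. *)
Lemma J_X_ldp_criterion (p : R) (s : nat -> R) (eta : nat -> Omega -> R) :
  0 < p ->
  (forall n, measurable_fun setT (eta n)) -> (forall n w, 0 <= eta n w) ->
  (forall n, (0 < n)%N -> 0 < s n) -> s n @[n --> \oo] --> +oo ->
  (forall x b, 0 < x -> b < x `^ p / p -> \forall n \near \oo,
     (P (eta n @^-1` [set y | (x <= y)%R]) <= (expR (- (b * s n)))%:E)%E) ->
  (forall x y z b, 0 <= x -> x < y -> y < z -> y `^ p / p < b ->
     \forall n \near \oo,
     ((expR (- (b * s n)))%:E <= P (eta n @^-1` [set u | (x < u < z)%R]))%E) ->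
  satisfies_LDP_GRF P eta s (@J_X R p).
Proof.
move=> p0 meta eta0 s0 soo upper lower.
have grf := @J_X_good R p p0.
have mpre n (B : set R) : measurable B -> measurable (eta n @^-1` B).
  by move=> mB; rewrite -[X in measurable X]setTI; exact: meta.
split=> //; split=> //.
- by move=> n B _ bB; apply: mpre; exact: borel_set_measurable.
- by case: grf.
move=> B /borel_set_measurable mB.
split; last 2 first.
- exact: limn_einf_sup.
- rewrite leeNr; apply: le_ereal_fin.
    by apply: le_ereal_inf_tmp => _ [x _ <-]; exact: J_X_ge0.
  move=> b b' bb' b'I; rewrite leeNr; apply: limn_esup_le_near.
  (* For b < 0 the bound is trivial, a probability being at most 1 <= e^(-b s_n). *)
  have [b0|b0] := ltP b 0.
    near=> n; have n0 : (0 < n)%N by near: n; exact: nbhs_infty_gt.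
    apply: log_prob_le; first exact: s0.
    apply: (@le_trans _ _ 1%E); first exact: probability_le1 (mpre _ _ mB).
    rewrite lee_fin -expR0 ler_expR oppr_ge0.
    by rewrite mulr_le0_ge0// ltW// s0.
  have b'0 : 0 < b' by exact: le_lt_trans bb'.
  (* The point where the rate equals b'. Since the infimum over the closure is at least b', values
     of [eta] in [B] are at least x. *)
  pose x := (p * b') `^ p^-1.
  have pb' : 0 < p * b' by rewrite mulr_gt0.
  have x0 : 0 < x by rewrite powR_gt0.
  have xp : x `^ p / p = b'.
    by rewrite powRK ?gt_eqF ?(ltW pb')// mulrC mulKf// gt_eqF.
  have xb : b < x `^ p / p by rewrite xp.
  have := upper _ _ x0 xb; apply: filter_app; near=> n => hn.
  have n0 : (0 < n)%N by near: n; exact: nbhs_infty_gt.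
  apply: log_prob_le; first exact: s0.
  apply: le_trans hn; apply: le_measure; rewrite ?inE.
  + exact: mpre.
  + by apply: mpre; rewrite -set_itvcy; exact: measurable_itv.
  move=> w /= Bw; rewrite leNgt; apply/negP => wx.
  have JI : (ereal_inf (J_X p @` closure B) <= J_X p (eta n w))%E.
    by apply: ereal_inf_lbound; exists (eta n w) => //; exact: subset_closure.
  have := le_trans b'I JI.
  rewrite /J_X eta0 lee_fin ler_pdivlMr// mulrC leNgt => /negP; apply.
  rewrite -(@powRK _ p (p * b'))// ?gt_eqF ?(ltW pb')//.
  by rewrite gt0_ltr_powR// nnegrE ?eta0// ltW.
rewrite leeNl; apply: le_ereal_inf_tmp => _ [x Bx <-]; rewrite leeNl.
rewrite /J_X; case: ifPn => [x0|_]; last by rewrite leNye.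
apply/lee_subgt0Pr => e e0.
have [r r0 xrB] : exists2 r : R, 0 < r & ball x r `<=` B.
  by move: Bx; rewrite /interior/= -nbhs_ballE => -[r r0 h]; exists r.
have xp0 : 0 <= x `^ p by exact: powR_ge0.
have xr : x `^ p < (x + r) `^ p.
  by rewrite gt0_ltr_powR ?nnegrE//; lra.
(* The point y with y^p = x^p + h then lies strictly between x and x + r, and its rate exceeds that
   of x by less than e. Moving to the right of x includes the case x = 0. *)
pose h := Num.min (p * e) ((x + r) `^ p - x `^ p) / 2.
have hm : 0 < Num.min (p * e) ((x + r) `^ p - x `^ p).
  by rewrite lt_min mulr_gt0//= subr_gt0.
have h0 : 0 < h by rewrite divr_gt0.
have he : h < p * e.
  have : Num.min (p * e) ((x + r) `^ p - x `^ p) <= p * e by rewrite ge_min lexx.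
  by rewrite /h; lra.
have hr : h < (x + r) `^ p - x `^ p.
  have : Num.min (p * e) ((x + r) `^ p - x `^ p) <= (x + r) `^ p - x `^ p.
    by rewrite ge_min lexx orbT.
  by rewrite /h; lra.
pose y := (x `^ p + h) `^ p^-1.
have yp : y `^ p = x `^ p + h by rewrite powRK ?gt_eqF// addr_ge0// ltW.
have y0 : 0 <= y by exact: powR_ge0.
have xy : x < y.
  rewrite ltNge; apply/negP => yx.
  have : y `^ p <= x `^ p by rewrite ge0_ler_powR ?nnegrE ?(ltW p0).
  by rewrite yp; lra.
have yz : y < x + r.
  rewrite ltNge; apply/negP => yx.
  have : (x + r) `^ p <= y `^ p.
    by rewrite ge0_ler_powR ?nnegrE ?(ltW p0)//; lra.
  by rewrite yp; lra.
have yb : y `^ p / p < x `^ p / p + e.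
  by rewrite yp mulrDl ltrD2l ltr_pdivrMr// mulrC.
rewrite -EFinN -EFinB -opprD; apply: limn_einf_ge_near.
have := lower _ _ _ _ x0 xy yz yb; apply: filter_app; near=> n => hn.
have n0 : (0 < n)%N by near: n; exact: nbhs_infty_gt.
apply: log_prob_ge; first exact: s0.
apply: (le_trans hn); apply: le_measure; rewrite ?inE.
- by apply: mpre; rewrite -set_itvoo; exact: measurable_itv.
- exact: mpre.
move=> w /= /andP[xw wz]; apply: xrB.
by rewrite /ball/= ltr_distlC; apply/andP; split; lra.
Unshelve. all: by end_near. Qed.

End ldp_criterion.

(** * Scaling sequences *)

Lemma cvgn_powR (R : realType) (a : R) : 0 < a ->
  (n%:R : R) `^ a @[n --> \oo] --> +oo.
Proof.
move=> a0; apply/cvgryPge => A.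
have [N AN] : exists N : nat, (Num.max A 0) `^ a^-1 <= N%:R.
  exists (Num.truncn (Num.max A 0 `^ a^-1)).+1.
  by have /andP[_ /ltW] := truncn_itv (powR_ge0 (Num.max A 0) a^-1).
exists N => // n /= Nn; apply: (@le_trans _ _ (Num.max A 0)).
  by rewrite le_max lexx.
rewrite -[leLHS](@powRK _ a); last 2 first.
- by rewrite gt_eqF.
- by rewrite le_max lexx orbT.
rewrite ge0_ler_powR ?nnegrE ?(ltW a0) ?powR_ge0//.
by apply: le_trans AN _; rewrite ler_nat.
Qed.

(** What the three regimes share. [sqrt_le_speed] makes polynomial factors e^(o(s_n)); [speed_small]
    leaves room in the ball for a coordinate of order tau_n; [scaling_speed] makes the cost of that
    coordinate of order s_n; [scaling_large] makes the cost of the tilt negligible. *)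
Record ldp_scaling (R : realType) (p : R) (tau s : nat -> R) : Prop :=
  LdpScaling {
    scaling_gt0 : forall n, (0 < n)%N -> 0 < tau n ;
    sqrt_le_speed : forall n, (0 < n)%N -> n%:R `^ 2^-1 <= s n ;
    speed_small : s n / n%:R @[n --> \oo] --> (0 : R) ;
    scaling_speed : tau n `^ p / s n @[n --> \oo] --> (1 : R) ;
    scaling_large : n%:R / tau n ^+ 2 @[n --> \oo] --> (0 : R) }.

Section scaling.
Context (R : realType) (p : R) (tau s : nat -> R).
Hypothesis hts : ldp_scaling p tau s.

Lemma speed_gt0 n : (0 < n)%N -> 0 < s n.
Proof.
move=> n0; apply: lt_le_trans (sqrt_le_speed hts n0).
by rewrite powR_gt0 ?ltr0n.
Qed.

Lemma speed_cvgy : s n @[n --> \oo] --> +oo.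
Proof.
have h2 : 0 < 2^-1 :> R by rewrite invr_gt0.
have := cvgn_powR h2; move=> /cvgryPge h; apply/cvgryPge => A.
near=> n; apply: (@le_trans _ _ (n%:R `^ 2^-1)).
  by near: n; exact: h.
by apply: sqrt_le_speed hts _ _; near: n; exact: nbhs_infty_gt.
Unshelve. all: by end_near. Qed.

Lemma cst_speed_cvg0 (a : R) : a / s n @[n --> \oo] --> (0 : R).
Proof.
rewrite -[X in _ --> X](mulr0 a); apply: cvgMr.
apply/gtr0_cvgV0; last exact: speed_cvgy.
by near=> n; apply: speed_gt0; near: n; exact: nbhs_infty_gt.
Unshelve. all: by end_near. Qed.

(** ln n = 4 ln n^(1/4) <= 4 n^(1/4), while s_n >= n^(1/2). *)
Lemma ln_speed_cvg0 : ln (n%:R : R) / s n @[n --> \oo] --> (0 : R).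
Proof.
have q0 : 0 < 4^-1 :> R by rewrite invr_gt0.
have V : 4 * ((n%:R : R) `^ 4^-1)^-1 @[n --> \oo] --> (0 : R).
  rewrite -[X in _ --> X](mulr0 4); apply: cvgMr.
  apply/gtr0_cvgV0; last exact: cvgn_powR.
  by near=> n; rewrite powR_gt0// ltr0n; near: n; exact: nbhs_infty_gt.
apply: (squeeze_cvgr _ (cvg_cst 0) V); near=> n.
have n0 : (0 < n)%N by near: n; exact: nbhs_infty_gt.
have nR0 : 0 < n%:R :> R by rewrite ltr0n.
have s0 := speed_gt0 n0.
apply/andP; split; first by rewrite divr_ge0 ?ln_ge0 ?ler1n// ltW.
rewrite ler_pdivrMr//.
have P4 : 0 < (n%:R : R) `^ 4^-1 by rewrite powR_gt0.
apply: (@le_trans _ _ (4 * ((n%:R : R) `^ 4^-1)^-1 * n%:R `^ 2^-1)); last first.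
  by rewrite ler_wpM2l ?(sqrt_le_speed hts n0).
have -> : (n%:R : R) `^ 2^-1 = n%:R `^ 4^-1 * n%:R `^ 4^-1.
  by rewrite -powRD ?(gt_eqF nR0) ?implybT//; congr (_ `^ _); lra.
rewrite -mulrA mulKf ?gt_eqF//.
have -> : ln (n%:R : R) = 4 * ln (n%:R `^ 4^-1) by rewrite ln_powR; field.
by rewrite ler_wpM2l// ltW// ln_sublinear.
Unshelve. all: by end_near. Qed.

Lemma lnsqr_speed_cvg0 : ln ((n * n).+1%:R : R) / s n @[n --> \oo] --> (0 : R).
Proof.
have U : ln (2 : R) / s n + 2 * (ln (n%:R : R) / s n) @[n --> \oo] --> (0 : R).
  rewrite -[X in _ --> X](addr0 0); apply: cvgD; first exact: cst_speed_cvg0.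
  by rewrite -[X in _ --> X](mulr0 2); apply: cvgMr; exact: ln_speed_cvg0.
apply: (squeeze_cvgr _ (cvg_cst 0) U); near=> n.
have n0 : (0 < n)%N by near: n; exact: nbhs_infty_gt.
have nR0 : 0 < n%:R :> R by rewrite ltr0n.
have s0 := speed_gt0 n0.
apply/andP; split; first by rewrite divr_ge0 ?ln_ge0 ?ler1n// ltW.
rewrite mulrA -mulrDl ler_pM2r ?invr_gt0//.
have -> : ln 2 + 2 * ln n%:R = ln (2 * (n%:R * n%:R)) :> R.
  rewrite !lnM ?posrE// ?mulr_gt0//; lra.
rewrite ler_ln ?posrE ?mulr_gt0//.
by rewrite -!natrM ler_nat mul2n -addnn -addn1 leq_add2l muln_gt0 n0.
Unshelve. all: by end_near. Qed.

(** The exponent of [sq_sum_tail] at T = t tau_n, polynomial factor included, divided by the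
    speed. *)
Lemma tail_exponent_cvg (t e C : R) : 0 < t ->
  (ln ((n * n).+1%:R : R) + (2 - (1 - e) * ((t * tau n) `^ p / p) *
    (1 - C * (n%:R / (t * tau n) ^+ 2)))) / s n @[n --> \oo] -->
  - ((1 - e) * (t `^ p / p)).
Proof.
move=> t0.
have -> : - ((1 - e) * (t `^ p / p)) = 0 + (0 -
   (1 - e) * (t `^ p / p) * 1 * (1 - C / t ^+ 2 * 0)) by ring.
apply: (@cvg_trans _ ((ln ((n * n).+1%:R : R) / s n + (2 / s n -
   (1 - e) * (t `^ p / p) * (tau n `^ p / s n) *
   (1 - C / t ^+ 2 * (n%:R / tau n ^+ 2)))) @[n --> \oo])).
  apply: near_eq_cvg; near=> n.
  have n0 : (0 < n)%N by near: n; exact: nbhs_infty_gt.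
  have s0 := speed_gt0 n0; have tau0 := scaling_gt0 hts n0.
  rewrite powRM ?(ltW t0) ?(ltW tau0)// exprMn.
  (* [field] needs p != 0; for p = 0 the inverse is 0 by convention and the terms divided by p
     vanish. *)
  have [->|p0] := eqVneq p 0; first by rewrite invr0; field; rewrite !gt_eqF.
  by field; rewrite p0 !gt_eqF.
apply: cvgD; first exact: lnsqr_speed_cvg0.
apply: cvgB; first exact: cst_speed_cvg0.
apply: cvgM; first by apply: cvgMr; exact: scaling_speed.
apply: cvgB; first exact: cvg_cst.
by apply: cvgMr; exact: scaling_large hts.
Unshelve. all: by end_near. Qed.

Lemma scalingX_small (y : R) : 0 <= y ->
  (y * tau n) `^ p / n%:R @[n --> \oo] --> (0 : R).
Proof.
move=> y0; have -> : (0 : R) = y `^ p * (1 * 0) by rewrite !mulr0.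
apply: (@cvg_trans _ (y `^ p * ((tau n `^ p / s n) * (s n / n%:R)) @[n --> \oo])).
  apply: near_eq_cvg; near=> n.
  have n0 : (0 < n)%N by near: n; exact: nbhs_infty_gt.
  have s0 := speed_gt0 n0; have tau0 := scaling_gt0 hts n0.
  rewrite powRM ?(ltW tau0)//; field.
  by rewrite !gt_eqF// ltr0n.
apply: cvgMr; apply: cvgM; [exact: scaling_speed|exact: speed_small hts].
Unshelve. all: by end_near. Qed.

(** The exponent of [sq_sum_window] at L' = y tau_n; D - ln n stands for a lower bound of its
    prefactor. *)
Lemma window_exponent_cvg (y D : R) : 0 <= y ->
  (D - ln (n%:R : R) - (y * tau n) `^ p / p / (1 - (y * tau n) `^ p / n%:R)) / s n
    @[n --> \oo] --> - (y `^ p / p).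
Proof.
move=> y0.
have -> : - (y `^ p / p) = 0 - 0 - (y `^ p / p * 1) * (1 - 0)^-1.
  by rewrite !subr0 invr1; ring.
apply: (@cvg_trans _ ((D / s n - ln (n%:R : R) / s n - (y `^ p / p *
   (tau n `^ p / s n)) * (1 - (y * tau n) `^ p / n%:R)^-1) @[n --> \oo])).
  apply: near_eq_cvg; near=> n.
  have n0 : (0 < n)%N by near: n; exact: nbhs_infty_gt.
  have s0 := speed_gt0 n0; have tau0 := scaling_gt0 hts n0.
  set w := (1 - _)^-1; rewrite (powRM _ y0 (ltW tau0)); ring.
apply: cvgB.
  by apply: cvgB; [exact: cst_speed_cvg0|exact: ln_speed_cvg0].
apply: cvgM; first by apply: cvgMr; exact: scaling_speed.
apply: cvgV; first by rewrite subr0 oner_neq0.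
by apply: cvgB; [exact: cvg_cst|exact: scalingX_small].
Unshelve. all: by end_near. Qed.

Lemma scaling_ge1 : \forall n \near \oo, 1 <= tau n.
Proof.
have : \forall n \near \oo, n%:R / tau n ^+ 2 <= 1.
  exact: (cvgr_le _ (scaling_large hts) _ ltr01).
apply: filter_app; near=> n => h.
have n0 : (0 < n)%N by near: n; exact: nbhs_infty_gt.
have tau0 := scaling_gt0 hts n0.
rewrite ler_pdivrMr ?exprn_gt0// mul1r in h.
rewrite -(@ler_pXn2r _ 2) ?nnegrE ?(ltW tau0)// expr1n.
by apply: le_trans h; rewrite ler1n.
Unshelve. all: by end_near. Qed.

End scaling.

(** * Large deviations of the norm *)

Lemma norm2_ge0 (R : realType) (n : nat) (x : n.-tuple R) : 0 <= norm2 x.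
Proof. exact: sqrtr_ge0. Qed.

Lemma norm2_sqr (R : realType) (n : nat) (x : n.-tuple R) :
  norm2 x ^+ 2 = sq_sum x.
Proof. by rewrite sqr_sqrtr ?sq_sum_ge0. Qed.

Lemma measurable_norm2 (R : realType) (n : nat) :
  measurable_fun [set: n.-tuple R] (@norm2 R n).
Proof.
apply: (@measurableT_comp _ _ _ _ _ _ (@Num.sqrt R)).
  by apply: continuous_measurable_fun; exact: sqrt_continuous.
exact: measurable_sq_sum.
Qed.

Lemma scaled_lp_ballE (R : realType) (p : R) (n : nat) : 0 < p -> (0 < n)%N ->
  @scale_tuple R n (n%:R `^ p^-1) @` lp_ball p n =
  [set x | lp_sum p x <= n%:R].
Proof.
move=> p0 n0; have n0' : 0 < n%:R :> R by rewrite ltr0n.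
set c := _ `^ _; have c0 : 0 < c by exact: powR_gt0.
have cp : c `^ p = n%:R by rewrite powRK// gt_eqF.
apply/seteqP; split=> [_ [x /= Bx <-]|x /= Sx].
  by rewrite lp_sum_scale ?(ltW c0)// cp ler_piMr// ltW.
have E : scale_tuple c (scale_tuple c^-1 x) = x.
  by apply: eq_from_tnth => i; rewrite !tnth_mktuple mulrA divff ?mul1r// gt_eqF.
exists (scale_tuple c^-1 x) => //; rewrite /lp_ball/=.
rewrite -[leRHS](divff (lt0r_neq0 n0')) ler_pdivlMr// mulrC -cp.
by rewrite -lp_sum_scale ?(ltW c0)// E cp.
Qed.

Section uniform.
Context (d : measure_display) (Omega : measurableType d) (R : realType)
  (P : probability Omega R) (p : R) (n : nat) (X : {RV P >-> n.-tuple R}).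
Hypotheses (p1 : 1 <= p) (n0 : (0 < n)%N).
Hypothesis hX : uniformly_distributed_on X
  (scale_tuple (n%:R `^ p^-1) @` lp_ball p n).

Let p0 : 0 < p. Proof. exact: lt_le_trans p1. Qed.

Let v : R := fine (lp_vol p n n%:R).

Let vE : lp_vol p n n%:R = v%:E.
Proof.
by rewrite /v fineK// ge0_fin_numE ?lp_vol_lty// measure_ge0.
Qed.

Let v0 : 0 < v.
Proof. by rewrite -lte_fin -vE lp_vol_gt0// n0 leqnn. Qed.

Lemma uniform_prob (A : set (n.-tuple R)) : measurable A ->
  P (X @^-1` A) =
  (lebesgue_tuple R n ([set x | lp_sum p x <= n%:R]%R `&` A) * (v^-1)%:E)%E.
Proof.
move=> mA; have := hX mA; rewrite /distribution /pushforward => ->.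
rewrite scaled_lp_ballE// setIC; congr (_ * _)%E.
by rewrite -/(lp_vol p n n%:R) vE inver gt_eqF.
Qed.

Lemma uniform_prob_le (A : set (n.-tuple R)) (c : R) : measurable A ->
  (lebesgue_tuple R n ([set x | lp_sum p x <= n%:R]%R `&` A) <=
   c%:E * lp_vol p n n%:R)%E -> (P (X @^-1` A) <= c%:E)%E.
Proof. by move=> mA; rewrite uniform_prob// lee_pdivrMr// vE. Qed.

Lemma uniform_prob_ge (A : set (n.-tuple R)) (c : R) : measurable A ->
  (c%:E * lp_vol p n n%:R <=
   lebesgue_tuple R n ([set x | lp_sum p x <= n%:R]%R `&` A))%E ->
  (c%:E <= P (X @^-1` A))%E.
Proof. by move=> mA; rewrite uniform_prob// lee_pdivlMr// vE. Qed.

End uniform.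

Lemma expR_ln_natM (R : realType) (m : nat) (a : R) :
  m.+1%:R * expR a = expR (ln (m.+1%:R) + a).
Proof. by rewrite expRD lnK// posrE. Qed.

Section ldp_norm2.
Context (d : measure_display) (Omega : measurableType d) (R : realType)
  (P : probability Omega R) (p : R) (X : forall n : nat, {RV P >-> n.-tuple R})
  (tau s : nat -> R).
Hypothesis p12 : 1 <= p <= 2.
Hypothesis hX : forall n : nat, (0 < n)%N -> uniformly_distributed_on (X n)
  (scale_tuple (n%:R `^ p^-1) @` lp_ball p n).
Hypothesis hts : ldp_scaling p tau s.

Let p1 : 1 <= p. Proof. by case/andP: p12. Qed.
Let p0 : 0 < p. Proof. exact: lt_le_trans p1. Qed.

Lemma norm2_upper (x b : R) : 0 < x -> b < x `^ p / p ->
  \forall n \near \oo,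
    (P ((fun w => (norm2 (X n w) / tau n)%R) @^-1` [set y | (x <= y)%R]) <=
     (expR (- (b * s n)))%:E)%E.
Proof.
move=> x0; set a := x `^ p / p => ba.
have a0 : 0 < a by rewrite divr_gt0// powR_gt0.
(* Then e a <= (a - b) / 2, hence b < (1 - e) a. The minimum with 1 matters when b < -a. *)
pose e := Num.min 1 ((a - b) / (2 * a)).
have e01 : 0 < e <= 1.
  rewrite /e lt_min ltr01 ge_min lexx /= andbT.
  by rewrite divr_gt0 ?subr_gt0// mulr_gt0.
have eb : b < (1 - e) * a.
  have : e * a <= (a - b) / (2 * a) * a by rewrite ler_pM2r// ge_min lexx orbT.
  rewrite (_ : (a - b) / (2 * a) * a = (a - b) / 2); last by field; rewrite gt_eqF.
  lra.
have [C C0 tail] := sq_sum_tail p12 e01.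
have lim := @tail_exponent_cvg R p tau s hts x e C x0.
have ltb : - ((1 - e) * (x `^ p / p)) < - b by rewrite ltrN2.
move: lim => /cvgr_lt/(_ _ ltb); apply: filter_app; near=> n => hn.
have n0 : (0 < n)%N by near: n; exact: nbhs_infty_gt.
have s0 := speed_gt0 hts n0; have tau0 := scaling_gt0 hts n0.
rewrite ltr_pdivrMr// in hn.
have T0 : 0 < x * tau n by rewrite mulr_gt0.
rewrite (_ : _ @^-1` _ = X n @^-1` [set y | (x * tau n) ^+ 2 <= sq_sum y]); last first.
  by apply/seteqP; split=> w /=;
    rewrite ler_pdivlMr// -norm2_sqr ler_sqr ?nnegrE ?norm2_ge0 ?(ltW T0).
apply: (uniform_prob_le p1 n0 (hX n0)); first exact: measurable_sq_sum_ge.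
have nn : (n <= n <= n.+1)%N by rewrite leqnn leqnSn.
apply: (le_trans (tail n n (x * tau n) n0 nn T0)).
rewrite lee_wpmul2r ?measure_ge0// lee_fin expR_ln_natM ler_expR.
by apply: (le_trans (ltW hn)); rewrite mulNr.
Unshelve. all: by end_near. Qed.

(** The tail bound in dimension n - 1 for the ball of size n: its exponent tends to -oo, so the
    fraction of volume with Q >= (t tau_n)^2 is eventually at most 1/2. Here e = 1/2 suffices. *)
Lemma norm2_bulk (t : R) : 0 < t -> \forall n \near \oo,
  (lebesgue_tuple R n.-1
    ([set x | lp_sum p x <= n%:R]%R `&` [set x | (t * tau n) ^+ 2 <= sq_sum x]%R)
   <= (2^-1)%:E * lp_vol p n.-1 n%:R)%E.
Proof.
move=> t0.
have e01 : 0 < (2^-1 : R) <= 1 by apply/andP; split; lra.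
have [C C0 tail] := sq_sum_tail p12 e01.
have lim := @tail_exponent_cvg R p tau s hts t 2^-1 C t0.
pose a := (1 - 2^-1) * (t `^ p / p).
have a0 : 0 < a.
  by rewrite mulr_gt0 ?divr_gt0 ?powR_gt0//; lra.
have lta : - a < - (a / 2) by lra.
move: lim => /cvgr_lt/(_ _ lta).
(* Then the exponent, below -(a/2) s_n, is at most -1, and e^(-1) <= 1/2. *)
have soo : \forall n \near \oo, 2 / a <= s n.
  by have /cvgryPge := speed_cvgy hts; exact.
move: soo; apply: filter_app2; near=> n => sa hn.
have n1 : (1 < n)%N by near: n; exact: nbhs_infty_gt.
have n0 : (0 < n)%N by exact: ltnW.
have s0 := speed_gt0 hts n0; have tau0 := scaling_gt0 hts n0.
rewrite ltr_pdivrMr// in hn.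
have T0 : 0 < t * tau n by rewrite mulr_gt0.
have k0 : (0 < n.-1)%N by rewrite -ltnS prednK.
have kn : (n.-1 <= n <= n.-1.+1)%N by apply/andP; split; [exact: leq_pred|rewrite prednK].
apply: (le_trans (tail n n.-1 (t * tau n) k0 kn T0)).
rewrite lee_wpmul2r ?measure_ge0// lee_fin.
apply: (@le_trans _ _ ((n * n).+1%:R * expR (2 - (1 - 2^-1) *
   ((t * tau n) `^ p / p) * (1 - C * (n%:R / (t * tau n) ^+ 2))))).
  by rewrite ler_wpM2r ?expR_ge0// ler_nat ltnS leq_mul2r leq_pred orbT.
rewrite expR_ln_natM; apply: (@le_trans _ _ (expR (- 1))).
  rewrite ler_expR; apply: (le_trans (ltW hn)).
  by move: sa; rewrite ler_pdivrMr// => sa; lra.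
rewrite expRN lef_pV2 ?posrE ?expR_gt0//.
by apply: le_trans (expR_ge1Dx _); lra.
Unshelve. all: by end_near. Qed.

(** One coordinate lies in [x1 tau_n, y tau_n] with x < x1 < y, and the others contribute at most (t
    tau_n)^2 to Q, where y^2 + t^2 < z^2. *)
Lemma norm2_lower (x y z b : R) : 0 <= x -> x < y -> y < z -> y `^ p / p < b ->
  \forall n \near \oo,
    ((expR (- (b * s n)))%:E <=
     P ((fun w => (norm2 (X n w) / tau n)%R) @^-1` [set u | (x < u < z)%R]))%E.
Proof.
move=> x0 xy yz yb.
have y0 : 0 < y by exact: le_lt_trans xy.
have z0 : 0 < z by exact: lt_trans yz.
pose x1 := (x + y) / 2.
have xx1 : x < x1 by rewrite /x1; lra.
have x1y : x1 < y by rewrite /x1; lra.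
pose t := Num.sqrt ((z ^+ 2 - y ^+ 2) / 2).
have yz2 : y ^+ 2 < z ^+ 2 by rewrite ltrXn2r// ?nnegrE ltW.
have tt : t ^+ 2 = (z ^+ 2 - y ^+ 2) / 2.
  by rewrite sqr_sqrtr// divr_ge0// subr_ge0 ltW.
have t0 : 0 < t by rewrite sqrtr_gt0 divr_gt0// subr_gt0.
(* The prefactor (y - x1) tau_n / (4 n^(1/p)) is at least e^D / n, since tau_n >= 1 eventually and
   n^(1/p) <= n. *)
pose D := ln ((y - x1) / 4).
have lim := @window_exponent_cvg R p tau s hts y D (ltW y0).
have ltb : - b < - (y `^ p / p) by rewrite ltrN2.
move: lim => /cvgr_gt/(_ _ ltb) W.
have S1 : \forall n \near \oo, (y * tau n) `^ p / n%:R < 1.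
  exact: (cvgr_lt _ (scalingX_small hts (ltW y0)) _ ltr01).
near=> n.
have n1 : (1 < n)%N by near: n; exact: nbhs_infty_gt.
have n0 : (0 < n)%N by exact: ltnW.
have s0 := speed_gt0 hts n0; have tau0 := scaling_gt0 hts n0.
have n0' : 0 < n%:R :> R by rewrite ltr0n.
have tau1 : 1 <= tau n by near: n; exact: scaling_ge1 hts.
have hn : - b < (D - ln (n%:R : R) - (y * tau n) `^ p / p /
   (1 - (y * tau n) `^ p / n%:R)) / s n by near: n.
have sn : (y * tau n) `^ p / n%:R < 1 by near: n.
have bulk : (lebesgue_tuple R n.-1
    ([set x | lp_sum p x <= n%:R]%R `&` [set x | (t * tau n) ^+ 2 <= sq_sum x]%R)
   <= (2^-1)%:E * lp_vol p n.-1 n%:R)%E by near: n; exact: norm2_bulk.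
rewrite ltr_pdivlMr// in hn; rewrite ltr_pdivrMr// mul1r in sn.
have k0 : (0 < n.-1)%N by rewrite -ltnS prednK.
have LL : 0 <= x1 * tau n < y * tau n.
  by rewrite ltr_pM2r// x1y mulr_ge0 ?(ltW tau0)// (le_trans x0)// ltW.
have := @sq_sum_window R p (x1 * tau n) (y * tau n) ((t * tau n) ^+ 2) n.-1 p1 k0 LL.
rewrite prednK// => /(_ sn bulk) win.
have mE : measurable [set u : n.-tuple R | (x1 * tau n) ^+ 2 <= sq_sum u <=
    (y * tau n) ^+ 2 + (t * tau n) ^+ 2].
  rewrite (_ : mkset _ = @sq_sum R n @^-1` `[(x1 * tau n) ^+ 2,
      (y * tau n) ^+ 2 + (t * tau n) ^+ 2]%classic); last first.
    by apply/seteqP; split=> u /=; rewrite in_itv.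
  by rewrite -[X in measurable X]setTI; exact: measurable_sq_sum.
apply: (@le_trans _ _ (P (X n @^-1` [set u | ((x1 * tau n) ^+ 2 <= sq_sum u <=
   (y * tau n) ^+ 2 + (t * tau n) ^+ 2)%R]))).
  apply: (uniform_prob_ge p1 n0 (hX n0)) => //.
  apply: le_trans win; rewrite lee_wpmul2r ?measure_ge0// lee_fin.
  apply: (@le_trans _ _ (expR (D - ln (n%:R : R) - (y * tau n) `^ p / p /
     (1 - (y * tau n) `^ p / n%:R)))).
    by rewrite ler_expR; apply: le_trans (ltW hn); rewrite mulNr.
  rewrite expRD ler_wpM2r ?expR_ge0// expRB !lnK ?posrE//; last first.
    by rewrite divr_gt0// subr_gt0.
  rewrite ler_pdivlMr ?mulr_gt0 ?powR_gt0//.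
  have -> : (y - x1) / 4 / n%:R * (4 * n%:R `^ p^-1) =
    (y - x1) * (n%:R `^ p^-1 / n%:R) by field; rewrite gt_eqF.
  rewrite -mulrBl ler_wpM2l ?subr_ge0 ?(ltW x1y)//.
  apply: le_trans tau1; rewrite ler_pdivrMr// mul1r.
  by rewrite ler1_powR ?ler1n// invf_le1.
apply: le_measure; rewrite ?inE.
- by rewrite -[X in measurable X]setTI; exact: measurable_funPT.
- rewrite -set_itvoo -[X in measurable X]setTI.
  apply: measurable_funM => //.
  apply: (measurableT_comp (@measurable_norm2 R n)); exact: measurable_funPT.
move=> w /= /andP[]; rewrite -norm2_sqr => h1 h2; apply/andP; split.
  rewrite ltr_pdivlMr//; apply: (@lt_le_trans _ _ (x1 * tau n)).
    by rewrite ltr_pM2r.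
  rewrite -ler_sqr ?nnegrE ?norm2_ge0//.
  by rewrite mulr_ge0 ?(ltW tau0)// (le_trans x0)// ltW.
rewrite ltr_pdivrMr// -ltr_sqr ?nnegrE ?norm2_ge0 ?mulr_ge0 ?(ltW tau0) ?(ltW z0)//.
apply: (le_lt_trans h2); rewrite !exprMn -mulrDl ltr_pM2r ?exprn_gt0// tt.
lra.
Unshelve. all: by end_near. Qed.

Lemma norm2_ldp : satisfies_LDP_GRF P
  (fun n w => norm2 (X n w) / tau n) s (@J_X R p).
Proof.
apply: J_X_ldp_criterion => //.
- move=> n; apply: measurable_funM => //.
  apply: (measurableT_comp (@measurable_norm2 R n)); exact: measurable_funPT.
(* The scaling is known to be positive for n >= 1 only; at n = 0 the empty tuple has norm 0. *)
- move=> n w; have [->|n0] := posnP n; last first.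
    by rewrite divr_ge0 ?norm2_ge0// ltW// (scaling_gt0 hts).
  by rewrite /norm2 big_ord0 sqrtr0 mul0r.
- exact: speed_gt0 hts.
- exact: speed_cvgy hts.
- exact: norm2_upper.
- exact: norm2_lower.
Qed.

End ldp_norm2.

(** * The three regimes *)

Section regimes.
Context (R : realType) (p : R) (k : nat -> nat).
Hypothesis hp : 1 <= p < 2.
Hypothesis hk : forall n : nat, (0 < n)%N -> (0 < k n <= n)%N.
Hypothesis hk_small : (k n)%:R / n%:R @[n --> \oo] --> (0 : R).

Let a := crit_exponent p.

Let p1 : 1 <= p. Proof. by case/andP: hp. Qed.

Let p0 : 0 < p. Proof. exact: lt_le_trans p1. Qed.

Let aE : a * (2 + p) = 2 * p.
Proof. by rewrite /a /crit_exponent; field; rewrite gt_eqF// addr_gt0. Qed.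

Let a_gt : 2^-1 <= a.
Proof.
rewrite -(ler_pM2r (_ : 0 < 2 + p)) ?addr_gt0// aE.
have : 1 <= p by []. lra.
Qed.

(** Equivalent to p < 2; this gives s_n / n -> 0 at the critical speed. *)
Let a_lt1 : a < 1.
Proof.
rewrite -(ltr_pM2r (_ : 0 < 2 + p)) ?addr_gt0// aE.
by case/andP: hp; lra.
Qed.

Let k_gt0 n : (0 < n)%N -> 0 < (k n)%:R :> R.
Proof. by move=> /hk/andP[k0 _]; rewrite ltr0n. Qed.

Let crit_gt0 n : (0 < n)%N -> 0 < crit_seq p n.
Proof. by move=> n0; rewrite powR_gt0// ltr0n. Qed.

Lemma crit_seq_cvgy : crit_seq p n @[n --> \oo] --> +oo.
Proof. by apply: cvgn_powR; apply: lt_le_trans a_gt; rewrite invr_gt0. Qed.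

Lemma sqrt_le_crit_seq n : (0 < n)%N -> n%:R `^ 2^-1 <= crit_seq p n.
Proof. by move=> n0; rewrite ler_powR// ler1n. Qed.

Lemma crit_seq_small : crit_seq p n / n%:R @[n --> \oo] --> (0 : R).
Proof.
have a1 : 0 < 1 - a by rewrite subr_gt0.
have V : ((n%:R : R) `^ (1 - a))^-1 @[n --> \oo] --> (0 : R).
  apply/gtr0_cvgV0; last exact: cvgn_powR.
  by near=> n; rewrite powR_gt0// ltr0n; near: n; exact: nbhs_infty_gt.
apply: cvg_trans V; apply: near_eq_cvg; near=> n.
have n0 : 0 < n%:R :> R by rewrite ltr0n; near: n; exact: nbhs_infty_gt.
rewrite -powRN opprB powRD ?(gt_eqF n0) ?implybT//.
by rewrite powR_inv1// ltW.
Unshelve. all: by end_near. Qed.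

Let powR_half_sqrt (x : R) : 0 <= x -> Num.sqrt x `^ p = x `^ (p / 2).
Proof. by move=> x0; rewrite -powR12_sqrt// -powRrM mulrC. Qed.

(** The critical exponent solves p - a p / 2 = a: at k_n = n^a the two formulas for the speed
    agree. *)
Let crit_balance n : (0 < n)%N ->
  n%:R `^ p * crit_seq p n `^ (- (p / 2)) = crit_seq p n.
Proof.
move=> n0; have nR0 : 0 < n%:R :> R by rewrite ltr0n.
rewrite /crit_seq -powRrM -powRD ?(gt_eqF nR0) ?implybT//.
by congr (_ `^ _); rewrite -/a; have := aE; lra.
Qed.

Lemma supercritical_near : supercritical p k ->
  \forall n \near \oo, crit_seq p n <= (k n)%:R.
Proof.
move=> /cvgr_lt/(_ 1 ltr01); apply: filter_app; near=> n => h.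
have n0 : (0 < n)%N by near: n; exact: nbhs_infty_gt.
by move: h; rewrite ltr_pdivrMr ?k_gt0// mul1r => /ltW.
Unshelve. all: by end_near. Qed.

Lemma super_speed_le n : (0 < n)%N -> crit_seq p n <= (k n)%:R ->
  n%:R `^ p * (k n)%:R `^ (- (p / 2)) <= crit_seq p n.
Proof.
move=> n0 ck; rewrite -[leRHS]crit_balance// ler_wpM2l ?powR_ge0//.
rewrite !powRN lef_pV2 ?posrE ?powR_gt0 ?(k_gt0 n0) ?ltr0n//.
by rewrite ge0_ler_powR ?nnegrE ?powR_ge0// divr_ge0// ltW.
Qed.

Lemma scaling_powR (m : R) n : 0 < m ->
  (n%:R / Num.sqrt m) `^ p = n%:R `^ p * m `^ (- (p / 2)).
Proof.
move=> m0; rewrite powRM ?invr_ge0 ?sqrtr_ge0//; congr (_ * _).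
rewrite -(powR_inv1 (sqrtr_ge0 m)) powRAC powR_half_sqrt ?(ltW m0)//.
by rewrite powR_inv1 ?powR_ge0// powRN.
Qed.

Lemma scaling_largeE (m : R) n : (0 < n)%N -> 0 < m ->
  n%:R / (n%:R / Num.sqrt m) ^+ 2 = m / n%:R.
Proof.
move=> n0 m0; rewrite expr_div_n sqr_sqrtr ?(ltW m0)//.
by field; rewrite !gt_eqF// ltr0n.
Qed.

(** Here tau_n^p = s_n exactly. As k_n <= n, s_n >= n^(p/2) >= n^(1/2); as k_n >= n^a eventually,
    s_n <= n^a = o(n). *)
Lemma supercritical_scaling : supercritical p k ->
  ldp_scaling p (fun n => n%:R / Num.sqrt (k n)%:R)
    (fun n => n%:R `^ p * (k n)%:R `^ (- (p / 2))).
Proof.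
move=> hsup; split.
- by move=> n n0; rewrite divr_gt0 ?ltr0n// sqrtr_gt0 k_gt0.
- move=> n n0; have nR0 : 0 < n%:R :> R by rewrite ltr0n.
  apply: (@le_trans _ _ (n%:R `^ p * n%:R `^ (- (p / 2)))).
    rewrite -powRD ?(gt_eqF nR0) ?implybT// ler_powR ?ler1n//.
    have : 1 <= p by []. lra.
  rewrite ler_wpM2l ?powR_ge0// !powRN lef_pV2 ?posrE ?powR_gt0 ?k_gt0 ?ltr0n//.
  rewrite ge0_ler_powR ?nnegrE ?divr_ge0 ?(ltW p0)// ler_nat.
  by case/andP: (hk n0).
- apply: (squeeze_cvgr _ (cvg_cst 0) crit_seq_small).
  have := supercritical_near hsup; apply: filter_app; near=> n => h.
  have n0 : (0 < n)%N by near: n; exact: nbhs_infty_gt.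
  rewrite mulr_ge0 ?mulr_ge0 ?powR_ge0 ?invr_ge0//=.
  by rewrite ler_pM2r ?invr_gt0 ?ltr0n// super_speed_le.
- apply: cvg_near_cst; near=> n.
  have n0 : (0 < n)%N by near: n; exact: nbhs_infty_gt.
  rewrite scaling_powR ?k_gt0// divff// mulf_neq0// gt_eqF// powR_gt0 ?k_gt0//.
  by rewrite ltr0n.
- apply: cvg_trans hk_small; apply: near_eq_cvg; near=> n.
  have n0 : (0 < n)%N by near: n; exact: nbhs_infty_gt.
  by rewrite scaling_largeE ?k_gt0.
Unshelve. all: by end_near. Qed.

Lemma supercritical_ratio : supercritical p k ->
  n%:R `^ p * (k n)%:R `^ (- (p / 2)) / (k n)%:R @[n --> \oo] --> (0 : R).
Proof.
move=> hsup; apply: (squeeze_cvgr _ (cvg_cst 0) hsup).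
have := supercritical_near hsup; apply: filter_app; near=> n => h.
have n0 : (0 < n)%N by near: n; exact: nbhs_infty_gt.
rewrite mulr_ge0 ?mulr_ge0 ?powR_ge0 ?invr_ge0//=.
by rewrite ler_pM2r ?invr_gt0 ?k_gt0// super_speed_le.
Unshelve. all: by end_near. Qed.

Lemma critical_ratio : critical p k ->
  (k n)%:R / crit_seq p n @[n --> \oo] --> (1 : R).
Proof.
move=> hc.
have V : (crit_seq p n)^-1 @[n --> \oo] --> (0 : R).
  apply/gtr0_cvgV0; last exact: crit_seq_cvgy.
  by near=> n; apply: crit_gt0; near: n; exact: nbhs_infty_gt.
have U : 1 + (crit_seq p n)^-1 @[n --> \oo] --> (1 : R).
  rewrite -[X in _ --> X]addr0; by apply: cvgD => //; exact: cvg_cst.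
have L : 1 - (crit_seq p n)^-1 @[n --> \oo] --> (1 : R).
  rewrite -[X in _ --> X]subr0; by apply: cvgB => //; exact: cvg_cst.
apply: (squeeze_cvgr _ L U); near=> n.
have n0 : (0 < n)%N by near: n; exact: nbhs_infty_gt.
have c0 := crit_gt0 n0.
have := hc n n0; rewrite ltr_distl => /andP[h1 h2].
rewrite ler_pdivlMr// ler_pdivrMr// mulrBl mulrDl mul1r mulVf ?gt_eqF//.
by apply/andP; split; lra.
Unshelve. all: by end_near. Qed.

Lemma critical_ratioV : critical p k ->
  crit_seq p n / (k n)%:R @[n --> \oo] --> (1 : R).
Proof.
move=> /critical_ratio h; rewrite -[X in _ --> X]invr1.
rewrite (_ : (fun n => _) = (fun n => ((k n)%:R / crit_seq p n)^-1)).
  by apply: cvgV => //; exact: oner_neq0.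
by apply/funext => n; rewrite invf_div.
Qed.

(** Rounding leaves tau_n^p / s_n = (n^a / k_n)^(p/2), which tends to 1 but need not equal it. *)
Lemma critical_scaling : critical p k ->
  ldp_scaling p (fun n => n%:R / Num.sqrt (k n)%:R) (crit_seq p).
Proof.
move=> hc; split.
- by move=> n n0; rewrite divr_gt0 ?ltr0n// sqrtr_gt0 k_gt0.
- exact: sqrt_le_crit_seq.
- exact: crit_seq_small.
- have q0 : 0 < p / 2 by rewrite divr_gt0.
  (* The limit is taken through the continuous maps [ln] and [expR], as [powR] is their composite at
     positive arguments. *)
  have h : (crit_seq p n / (k n)%:R) `^ (p / 2) @[n --> \oo] --> (1 : R).
    have l : ln (crit_seq p n / (k n)%:R) @[n --> \oo] --> (0 : R).
      rewrite -[X in _ --> X](@ln1 R); apply: continuous_cvg (critical_ratioV hc).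
      exact: continuous_ln.
    have l' : p / 2 * ln (crit_seq p n / (k n)%:R) @[n --> \oo] --> (0 : R).
      by rewrite -[X in _ --> X](mulr0 (p / 2)); apply: cvgMr.
    have : expR (p / 2 * ln (crit_seq p n / (k n)%:R)) @[n --> \oo] --> (1 : R).
      rewrite -[X in _ --> X](@expR0 R).
      by apply: continuous_cvg l'; exact: continuous_expR.
    apply: cvg_trans; apply: near_eq_cvg; near=> n.
    have n0 : (0 < n)%N by near: n; exact: nbhs_infty_gt.
    by rewrite /powR gt_eqF// divr_gt0 ?k_gt0 ?crit_gt0.
  apply: cvg_trans h; apply: near_eq_cvg; near=> n.
  have n0 : (0 < n)%N by near: n; exact: nbhs_infty_gt.
  have c0 := crit_gt0 n0; have kn0 := k_gt0 n0.
  have np : n%:R `^ p = crit_seq p n * crit_seq p n `^ (p / 2).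
    by rewrite -{1}(crit_balance n0) powRN divfK// gt_eqF// powR_gt0.
  rewrite scaling_powR// powRM ?invr_ge0 ?(ltW c0) ?(ltW kn0)// np.
  rewrite -(powR_inv1 (ltW kn0)) -powRrM mulN1r.
  by field; rewrite gt_eqF.
- apply: cvg_trans hk_small; apply: near_eq_cvg; near=> n.
  have n0 : (0 < n)%N by near: n; exact: nbhs_infty_gt.
  by rewrite scaling_largeE ?k_gt0.
Unshelve. all: by end_near. Qed.

Lemma subcritical_scaling :
  ldp_scaling p (fun n => n%:R / Num.sqrt (crit_seq p n)) (crit_seq p).
Proof.
split.
- by move=> n n0; rewrite divr_gt0 ?ltr0n// sqrtr_gt0 crit_gt0.
- exact: sqrt_le_crit_seq.
- exact: crit_seq_small.
- apply: cvg_near_cst; near=> n.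
  have n0 : (0 < n)%N by near: n; exact: nbhs_infty_gt.
  by rewrite scaling_powR ?crit_gt0// crit_balance// divff// gt_eqF// crit_gt0.
- apply: cvg_trans crit_seq_small; apply: near_eq_cvg; near=> n.
  have n0 : (0 < n)%N by near: n; exact: nbhs_infty_gt.
  by rewrite scaling_largeE ?crit_gt0.
Unshelve. all: by end_near. Qed.

Lemma subcritical_ratio : subcritical p k ->
  crit_seq p n / (k n)%:R @[n --> \oo] --> +oo.
Proof.
move=> h; apply/gtr0_cvgV0.
  near=> n; have n0 : (0 < n)%N by near: n; exact: nbhs_infty_gt.
  by rewrite divr_gt0 ?k_gt0 ?crit_gt0.
by apply: cvg_trans h; apply: near_eq_cvg; near=> n; rewrite /= invf_div.
Unshelve. all: by end_near. Qed.

(** Together with its subcritical analogue, this makes the test in [ldp_speed] select [crit_seq]. *)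
Lemma critical_Nsupercritical : critical p k -> ~ supercritical p k.
Proof.
move=> /critical_ratioV h1 h0.
have : (0 : R) = 1 by exact: (cvg_unique _ h0 h1).
by move/eqP; rewrite eq_sym oner_eq0.
Qed.

Lemma subcritical_Nsupercritical : subcritical p k -> ~ supercritical p k.
Proof.
move=> /subcritical_ratio/cvgryPge/(_ 1) h /cvgr_lt/(_ 1 ltr01) h1.
have : \forall n \near \oo, 1 <= crit_seq p n / (k n)%:R /\
    crit_seq p n / (k n)%:R < 1.
  by move: h h1; apply: filter_app2; near=> n.
move=> /filter_ex[n []].
by move=> /le_lt_trans h2 /h2; rewrite ltxx.
Unshelve. all: by end_near. Qed.

End regimes.

(** The limit r is 0, 1 and +oo in the three regimes, so exactly one of the two alternatives is live
    in each; all cases are [norm2_ldp] for tau_n = n / sqrt m, with m = k_n or m = s_n. *)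
Theorem proposition3p4 (R : realType) (d : measure_display)
    (Omega : measurableType d) (P : probability Omega R)
    (p : R) (X : forall n : nat, {RV P >-> n.-tuple R}) (k : nat -> nat)
    (hp : 1 <= p < 2)
    (hX : forall n : nat, (0 < n)%N ->
      uniformly_distributed_on (X n)
        (scale_tuple (n%:R `^ p^-1) @` lp_ball p n))
    (hk : forall n : nat, (0 < n)%N -> (0 < k n <= n)%N)
    (hk_infty : (k n)%:R @[n --> \oo] --> (+oo : set_system R))
    (hk_small : (k n)%:R / n%:R @[n --> \oo] --> (0 : R))
    (hregime : [\/ supercritical p k, critical p k | subcritical p k]) :
  let s := ldp_speed p k in
  [/\ s n @[n --> \oo] --> (+oo : set_system R),
      s n / n%:R @[n --> \oo] --> (0 : R) &
      exists r : \bar R,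
        [/\ (0 <= r)%E,
            (s n / (k n)%:R)%:E @[n --> \oo] --> r,
            (r < +oo)%E ->
              satisfies_LDP_GRF P
                (fun n w => Num.sqrt (k n)%:R * norm2 (X n w) / n%:R)
                s (J_X p) &
            r = +oo%E ->
              satisfies_LDP_GRF P
                (fun n w => Num.sqrt (s n) * norm2 (X n w) / n%:R)
                s (J_X p)]].
Proof.
have p12 : 1 <= p <= 2 by case/andP: hp => -> /ltW.
have etaE (m : nat -> R) :
    (fun n w => Num.sqrt (m n) * norm2 (X n w) / n%:R) =
    (fun n w => norm2 (X n w) / (n%:R / Num.sqrt (m n))).
  by apply/funext => n; apply/funext => w; rewrite invf_div [RHS]mulrCA mulrA.
move=> s; case: hregime => [hsup|hcrit|hsub].
- have sE : s = fun n => n%:R `^ p * (k n)%:R `^ (- (p / 2)).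
    by apply/funext => n; rewrite /s /ldp_speed asboolT.
  have sc := supercritical_scaling hp hk hk_small hsup.
  rewrite sE; split; [exact: speed_cvgy sc|exact: speed_small sc|].
  exists 0%E; split=> //.
    by apply: cvg_EFin; [exact: nearW|exact: supercritical_ratio].
  by move=> _; rewrite etaE; exact: norm2_ldp sc.
- have sE : s = crit_seq p.
    apply/funext => n; rewrite /s /ldp_speed asboolF//.
    exact: critical_Nsupercritical.
  have sc := critical_scaling hp hk hk_small hcrit.
  rewrite sE; split; [exact: speed_cvgy sc|exact: speed_small sc|].
  exists 1%E; split=> //.
    by apply: cvg_EFin; [exact: nearW|exact: critical_ratioV].
  by move=> _; rewrite etaE; exact: norm2_ldp sc.
- have sE : s = crit_seq p.
    apply/funext => n; rewrite /s /ldp_speed asboolF//.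
    exact: subcritical_Nsupercritical.
  have sc := subcritical_scaling hp.
  rewrite sE; split; [exact: speed_cvgy sc|exact: speed_small sc|].
  exists +oo%E; split=> //.
    by apply/cvgeryP; exact: subcritical_ratio.
  by move=> _; rewrite etaE; exact: norm2_ldp sc.
Qed.
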